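(* Let $\sigma,\omega$ be locally finite Borel measures on $\mathbb{R}^d$, let $1<q<p<\infty$, and let $\{\lambda_Q\}_{Q\in\mathcal{D}}$ be non-negative reals. For $Q\in\mathcal{D}$ put $$\Lambda_Q:=\frac{1}{\omega(Q)}\sum_{R\in\mathcal{D}:R\subseteq Q}\lambda_R\,\omega(R).$$ Then the following assertions are equivalent: (i) There is a finite constant $C$ such that $$\Big\|\sum_{Q\in\mathcal{D}}\lambda_Q\langle f\rangle^\sigma_Q1_Q\Big\|_{L^q(\omega)}\le C\|f\|_{L^p(\sigma)}\quad\text{for all functions }f.$$ (ii) There is a finite constant $C$ such that both $$\Big\|\sup_{Q\in\mathcal{D}}\Lambda_Q\langle f\rangle^\sigma_Q1_Q\Big\|_{L^q(\omega)}\le C\|f\|_{L^p(\sigma)}\quad\text{for all functions }f$$ and $$\Big\|\sup_{Q\in\mathcal{D}}\frac{\omega(Q)}{\sigma(Q)}\Lambda_Q\langle g\rangle^\omega_Q1_Q\Big\|_{L^{p'}(\sigma)}\le C\|g\|_{L^{q'}(\omega)}\quad\text{for all functions }g.$$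
   Context: $\mathcal{D}$ is the collection of all dyadic cubes in $\mathbb{R}^d$. For a measure $\mu$ and $Q\in\mathcal D$, $\langle f\rangle^\mu_Q:=\frac{1}{\mu(Q)}\int_Q|f|\,d\mu$. The Hölder conjugates are $p'=\frac{p}{p-1}$, $q'=\frac{q}{q-1}$. Convention: $\frac00:=0$.
   Formalization: It is assumed in addition that λ_Q ω(Q) = 0 whenever σ(Q) = 0, so that ω(Q)Λ_Q/σ(Q) is never of the form positive/0, which the convention 0/0 := 0 does not define; without this, (i) does not imply (ii). *)

(* Defs.v *)
Set Warnings "-all".
From mathcomp Require Export all_boot all_order all_algebra.
From mathcomp Require Export all_classical all_reals all_analysis.
Export Order.TTheory GRing.Theory Num.Theory.
Export numFieldNormedType.Exports.

Set Implicit Arguments.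
Unset Strict Implicit.
Unset Printing Implicit Defensive.

Local Open Scope classical_set_scope.
Local Open Scope ring_scope.
Local Open Scope ereal_scope.

(* R^d with its Borel sigma-algebra *)
Notation Rn R d := (g_sigma_algebraType (@open 'rV[R]_d)).

Definition locally_finite (R : realType) (d : nat)
    (mu : {measure set (Rn R d) -> \bar R}) : Prop :=
  forall x : 'rV[R]_d,
    exists U : set 'rV[R]_d, [/\ open U, U x & mu U < +oo].

(* 2^-k ([0, 1[^d + m) *)
Definition dyadic_cube (R : realType) (d : nat) (k : int) (m : 'rV[int]_d)
    : set (Rn R d) :=
  [set x : 'rV[R]_d | forall i : 'I_d,
     ((2 : R) ^ (- k) * (m ord0 i)%:~R <= x ord0 i
        < (2 : R) ^ (- k) * ((m ord0 i)%:~R + 1))%R].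

Definition dyadic (R : realType) (d : nat) : set (set (Rn R d)) :=
  [set Q | exists (k : int) (m : 'rV[int]_d), Q = dyadic_cube k m].
Arguments dyadic R d : clear implicits.

(* In \bar R one has 0^-1 = +oo and 0 * +oo = 0, hence 0 / 0 = 0; this is the
   convention in force in all the quotients below. *)
Definition average (R : realType) (d : nat)
    (mu : {measure set (Rn R d) -> \bar R}) (f : Rn R d -> R)
    (Q : set (Rn R d)) : \bar R :=
  (\int[mu]_(x in Q) `|f x|%:E) / mu Q.

(* Extended-real valued: the series may diverge. *)
Definition Lambda (R : realType) (d : nat)
    (omega : {measure set (Rn R d) -> \bar R}) (lambda : set (Rn R d) -> R)
    (Q : set (Rn R d)) : \bar R :=
  (\esum_(S in [set S | dyadic R d S /\ S `<=` Q]) ((lambda S)%:E * omega S))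
  / omega Q.

Definition dyadic_sum (R : realType) (d : nat)
    (a : set (Rn R d) -> \bar R) (x : Rn R d) : \bar R :=
  \esum_(Q in dyadic R d) (a Q * (\1_Q x)%:E).

Definition dyadic_sup (R : realType) (d : nat)
    (a : set (Rn R d) -> \bar R) (x : Rn R d) : \bar R :=
  ereal_sup [set a Q * (\1_Q x)%:E | Q in dyadic R d].

(* Main.v *)
(** Write [kappa_Q = lambda_Q omega(Q)] and let [B(f, g)] be the sum over [Q] of
    [kappa_Q <f>_Q <g>_Q], the averages being taken with respect to [sigma] and
    [omega]. By duality (i) is the boundedness of [B] on [L^p(sigma)] times
    [L^q'(omega)], and this formulation is symmetric in the two measures.

    If [B] is bounded, then [Lambda_Q <f>_Q] is at most the [omega]-average over
    [Q] of the positive operator applied to the maximal function of [f], and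
    Doob's inequality is used twice. Conversely, on a finite family of cubes let
    [a_Q] and [b_Q] be the maxima of the averages of [f] and [g] over the
    ancestors of [Q]. Writing [a_Q b_Q] as the telescoping sum, along the
    ancestors [S] of [Q], of the increments of [a b] and exchanging the sums
    gives
    [B(f, g) <= sum_S K_S (a_S (delta b)_S + b_S (delta a)_S)], where [K_S] is
    the sum of the [kappa_Q] over [Q] inside [S]. Along a point the increments
    of [b] sum up to at most the maximal function of [g], so that the first half
    is at most the [omega]-integral of
    [sup_S (K_S / omega(S) <Mf>_S 1_S)] times [Mg]; the second half is
    symmetric. Doob's inequality is itself proved by the same telescoping,
    applied to [a^p]. *)

Require Import Defs.
From mathcomp Require Import measurable_realfun ring lra.

Set Implicit Arguments.
Unset Strict Implicit.
Unset Printing Implicit Defensive.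

Local Open Scope classical_set_scope.
Local Open Scope ring_scope.

(** * Running maxima along chains *)

Section chains.
Context {disp : Order.disp_t} {K : porderType disp}.

(** Once [s] is sorted increasingly, the filter [x <= y] is the tail starting at [x] and [x < y] the
    tail after it, so consecutive differences cancel. Invariance of [G] under permutations allows
    the sorting. *)
Lemma telescope_chain (V : zmodType) (G : seq K -> V) (s : seq K) :
  (forall s1 s2, perm_eq s1 s2 -> G s1 = G s2) ->
  uniq s -> {in s &, total (@Order.le disp K)} ->
  \sum_(x <- s) (G [seq y <- s | (x <= y)%O] - G [seq y <- s | (x < y)%O])
    = G s - G [::].
Proof.
move=> Gperm us tot.
have /(sort_sorted_in tot) : all (mem s) s by apply/allP.
have := permEl (perm_sort (@Order.le disp K) s).
move: (sort _ s) => t ts st.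
transitivity (\sum_(x <- t) (G [seq y <- t | (x <= y)%O]
                             - G [seq y <- t | (x < y)%O])).
  rewrite (perm_big t) 1?perm_sym//=; apply: eq_bigr => x _.
  by congr (_ - _); apply: Gperm; apply: perm_filter; rewrite perm_sym.
rewrite -(Gperm _ _ ts); move: us; rewrite -(perm_uniq ts) => ut.
elim: t st ut {ts tot s} => [|m s ih] st /=.
  by rewrite big_nil subrr.
move=> /andP[ms us]; have mle : all (fun y => m <= y)%O s.
  by apply: order_path_min => //; exact: le_trans.
have mlt : all (fun y => m < y)%O s.
  apply/allP => y ys; rewrite lt_neqAle (allP mle _ ys) andbT.
  by apply: contra ms => /eqP ->.
rewrite big_cons lexx ltxx (all_filterP mle) (all_filterP mlt).
rewrite big_seq (eq_bigr (fun x => G [seq y <- s | (x <= y)%O]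
                             - G [seq y <- s | (x < y)%O])); last first.
  move=> x xs; have mx := allP mlt _ xs.
  by rewrite (lt_geF mx) (lt_gtF mx).
by rewrite -big_seq ih ?(path_sorted st)// addrA subrK.
Qed.

Context {R : realDomainType}.
Implicit Types (u v : K -> R) (F : seq K).

(** For sets ordered by inclusion, these are the running maxima over the ancestors of [x] in [F],
    with [x] included or excluded. The default 0 is below every average. *)
Definition maxge u F x : R := \big[Order.max/0]_(y <- F | (x <= y)%O) u y.
Definition maxgt u F x : R := \big[Order.max/0]_(y <- F | (x < y)%O) u y.

Lemma maxgt_ge0 u F x : 0 <= maxgt u F x.
Proof. exact: bigmax_ge_id. Qed.

Lemma maxge_ge0 u F x : 0 <= maxge u F x.
Proof. exact: bigmax_ge_id. Qed.

Lemma le_maxge u F x : x \in F -> u x <= maxge u F x.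
Proof. by move=> xF; apply: le_bigmax_seq. Qed.

Lemma maxgt_le_maxge u F x : maxgt u F x <= maxge u F x.
Proof.
rewrite /maxgt big_seq_cond; apply: bigmax_le; first exact: maxge_ge0.
by move=> y /andP[yF xy]; apply: le_bigmax_seq => //; exact: ltW.
Qed.

Lemma maxgeE u F x : x \in F -> maxge u F x = Num.max (u x) (maxgt u F x).
Proof.
move=> xF; apply/le_anti/andP; split; last first.
  by rewrite ge_max le_maxge// maxgt_le_maxge.
rewrite [leLHS]/maxge big_seq_cond; apply: bigmax_le.
  by rewrite le_max maxgt_ge0 orbT.
move=> y /andP[yF]; rewrite le_eqVlt => /predU1P[->|xy].
  by rewrite le_max lexx.
by rewrite le_max; apply/orP; right; apply: le_bigmax_seq.
Qed.

(** Since [P] is upward closed, an element of [P] has all its ancestors in [P], and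
    [telescope_chain] applies to the members of [F] in [P]. It serves for [phi] a product with [P]
    the ancestors of a set, and for [phi] a power with [P] the sets containing a point. *)
Lemma telescope_max (phi : R -> R -> R) u v F (P : pred K) :
  uniq F -> {in P, forall x y, (x <= y)%O -> P y} ->
  {in [pred x in F | P x] &, total (@Order.le disp K)} ->
  \sum_(x <- F | P x) (phi (maxge u F x) (maxge v F x)
                       - phi (maxgt u F x) (maxgt v F x))
  = phi (\big[Order.max/0]_(y <- F | P y) u y)
        (\big[Order.max/0]_(y <- F | P y) v y) - phi 0 0.
Proof.
move=> uF Pup tot.
pose G (s : seq K) := phi (\big[Order.max/0]_(y <- s) u y)
                          (\big[Order.max/0]_(y <- s) v y).
have Gperm s1 s2 : perm_eq s1 s2 -> G s1 = G s2.
  move=> s12; rewrite /G.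
  have E (w : K -> R) :
      \big[Order.max/0]_(y <- s1) w y = \big[Order.max/0]_(y <- s2) w y.
    apply/le_anti/andP; split.
      by apply: sub_bigmax_seq => y; rewrite (perm_mem s12).
    by apply: sub_bigmax_seq => y; rewrite (perm_mem s12).
  by rewrite !E.
have := @telescope_chain _ G [seq x <- F | P x] Gperm (filter_uniq _ uF).
rewrite /G !big_filter !big_nil => <-; last first.
  move=> x y; rewrite !mem_filter => /andP[Px xF] /andP[Py yF].
  by apply: tot; rewrite inE ?xF ?yF.
apply: eq_bigr => x Px; rewrite -!filter_predI.
have E1 : [seq y <- F | predI (fun y => (x <= y)%O) P y]
    = [seq y <- F | (x <= y)%O].
  apply: eq_filter => y /=; have [xy|//] := boolP (x <= y)%O.
  exact: Pup xy.
have E2 : [seq y <- F | predI (fun y => (x < y)%O) P y]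
    = [seq y <- F | (x < y)%O].
  apply: eq_filter => y /=; have [xy|//] := boolP (x < y)%O.
  exact: Pup (ltW xy).
by rewrite E1 E2 !big_filter.
Qed.

(* Abel summation along the chains of ancestors: the product of the running
   maxima of [u] and [v] telescopes. *)
Lemma abel_chain_le (kappa u v : K -> R) F : uniq F ->
  {in F, forall x, 0 <= kappa x} ->
  (forall x, 0 <= u x) -> (forall x, 0 <= v x) ->
  (forall x, x \in F -> kappa x != 0 ->
     {in [pred y in F | (x <= y)%O] &, total (@Order.le disp K)}) ->
  \sum_(x <- F) kappa x * u x * v x <=
  \sum_(y <- F) (\sum_(x <- F | (x <= y)%O) kappa x) *
    (maxge u F y * (maxge v F y - maxgt v F y)
     + maxge v F y * (maxge u F y - maxgt u F y)).
Proof.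
move=> uF k0 u0 v0 tot.
under [leRHS]eq_bigr do rewrite mulr_suml.
rewrite (exchange_big_dep xpredT)//= [leLHS]big_seq [leRHS]big_seq.
apply: ler_sum => x xF; have [->|kx] := eqVneq (kappa x) 0.
  by rewrite !mul0r big1// => y _; rewrite mul0r.
rewrite -mulr_sumr -mulrA ler_wpM2l ?k0//.
apply: (@le_trans _ _ (maxge u F x * maxge v F x)).
  by rewrite ler_pM// le_maxge.
have := @telescope_max (fun a b => a * b) u v F (fun y => x <= y)%O uF.
rewrite mulr0 subr0 /maxge => <-; last 2 first.
- by move=> y xy z yz; exact: le_trans xy yz.
- exact: tot.
(* With primes for the maxima over proper ancestors, [a b - a' b' = a (b - b') + b' (a - a')], and
   [b' <= b]. *)
apply: ler_sum => y xy; rewrite -/(maxge u F y) -/(maxge v F y).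
have := maxgt_le_maxge u F y; have := maxgt_le_maxge v F y.
have := maxgt_ge0 u F y; have := maxgt_ge0 v F y.
nra.
Qed.

End chains.

Local Open Scope ereal_scope.

(** * Lp norms of extended-real-valued functions *)

Section Lnorm_extra.
Context {d : measure_display} {T : measurableType d} {R : realType}.
Variable mu : {measure set T -> \bar R}.
Implicit Types (F G : T -> \bar R) (p q : R).

Lemma LnormE p F :
  'N[mu]_p%:E[F] = (\int[mu]_x `|F x| `^ p) `^ p^-1.
Proof. by rewrite unlock. Qed.

Lemma measurable_abse_poweR F p : measurable_fun setT F ->
  measurable_fun setT (fun x => `|F x| `^ p).
Proof.
move=> mF; apply: (measurableT_comp (measurable_poweR p)).
exact: measurableT_comp.
Qed.

Lemma le_poweR (x y : \bar R) p : (0 <= p)%R -> 0 <= x -> x <= y ->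
  x `^ p <= y `^ p.
Proof.
move=> p0 x0 xy; apply: gt0_ler_poweR => //; rewrite in_itv/= ?x0 leey//.
by rewrite andbT (le_trans x0).
Qed.

Lemma le_Lnorm p F G : (0 < p)%R ->
  measurable_fun setT F -> measurable_fun setT G ->
  (forall x, `|F x| <= `|G x|) -> 'N[mu]_p%:E[F] <= 'N[mu]_p%:E[G].
Proof.
move=> p0 mF mG FG; rewrite !LnormE; apply: le_poweR.
- by rewrite invr_ge0 ltW.
- by apply: integral_ge0 => x _; exact: poweR_ge0.
- apply: ge0_le_integral => //.
  + by move=> x _; exact: poweR_ge0.
  + exact: measurable_abse_poweR.
  + exact: measurable_abse_poweR.
  + by move=> x _; apply: le_poweR => //; exact: ltW.
Qed.

Lemma Lnorm_le_pow p F (C : \bar R) : (0 < p)%R -> 0 <= C ->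
  \int[mu]_x `|F x| `^ p <= C `^ p -> 'N[mu]_p%:E[F] <= C.
Proof.
move=> p0 C0 FC; rewrite LnormE.
rewrite [leRHS](_ : C = (C `^ p) `^ p^-1); last first.
  by rewrite -poweRrM mulfV ?gt_eqF// poweRe1.
apply: le_poweR => //; first by rewrite invr_ge0 ltW.
by apply: integral_ge0 => x _; exact: poweR_ge0.
Qed.

Lemma int_pow_le p F (C : \bar R) : (0 < p)%R ->
  'N[mu]_p%:E[F] <= C -> \int[mu]_x `|F x| `^ p <= C `^ p.
Proof.
move=> p0 FC; rewrite -poweR_Lnorm ?gt_eqF//; apply: le_poweR.
- exact: ltW.
- exact: Lnorm_ge0.
- exact: FC.
Qed.

Lemma Lnorm_lty p F : (0 < p)%R -> 'N[mu]_p%:E[F] < +oo ->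
  \int[mu]_x `|F x| `^ p < +oo.
Proof. by move=> p0 FC; rewrite -poweR_Lnorm ?gt_eqF// poweR_lty. Qed.

Lemma ae_eq_Lnorm p F G :
  measurable_fun setT F -> measurable_fun setT G ->
  ae_eq mu setT F G -> 'N[mu]_p%:E[F] = 'N[mu]_p%:E[G].
Proof.
move=> mF mG FG; rewrite !LnormE; congr (_ `^ _).
apply: ae_eq_integral => //; try exact: measurable_abse_poweR.
by apply: filterS FG => x /= /[apply] ->.
Qed.

(** A finite norm makes [|F|^p] integrable, hence finite almost everywhere. This replaces
    extended-real functions, such as maximal functions, by real ones. *)
Lemma fine_Lnorm_ae p F : (0 < p)%R -> measurable_fun setT F ->
  'N[mu]_p%:E[F] < +oo -> ae_eq mu setT (EFin \o (fine \o F)) F.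
Proof.
move=> p0 mF /(Lnorm_lty p0) Foo.
have : mu.-integrable setT (fun x => `|F x| `^ p).
  apply/integrableP; split; first exact: measurable_abse_poweR.
  by under eq_integral do rewrite gee0_abs ?poweR_ge0//.
move=> /(integrable_ae measurableT); apply: filterS => x /= /[apply].
rewrite fin_numElt => /andP[_ /(lty_poweRy (lt0r_neq0 p0))].
by case: (F x).
Qed.

Lemma measurable_fine_comp F : measurable_fun setT F ->
  measurable_fun setT (fine \o F).
Proof. by move=> mF; apply: measurableT_comp. Qed.

Lemma ehoelder p q F G : (0 < p)%R -> (0 < q)%R -> (p^-1 + q^-1 = 1)%R ->
  measurable_fun setT F -> measurable_fun setT G ->
  'N[mu]_p%:E[F] < +oo -> 'N[mu]_q%:E[G] < +oo ->
  \int[mu]_x `|F x * G x| <= 'N[mu]_p%:E[F] * 'N[mu]_q%:E[G].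
Proof.
move=> p0 q0 pq mF mG Foo Goo.
have aF := fine_Lnorm_ae p0 mF Foo; have aG := fine_Lnorm_ae q0 mG Goo.
have mf := measurable_fine_comp mF; have mg := measurable_fine_comp mG.
have mfE : measurable_fun setT (EFin \o (fine \o F)) by exact/measurable_EFinP.
have mgE : measurable_fun setT (EFin \o (fine \o G)) by exact/measurable_EFinP.
rewrite -(ae_eq_Lnorm _ mfE mF aF) -(ae_eq_Lnorm _ mgE mG aG).
apply: le_trans (hoelder mu mf mg p0 q0 pq); rewrite Lnorm1.
rewrite le_eqVlt; apply/orP; left; apply/eqP; apply: ae_eq_integral => //.
- by apply: measurableT_comp => //; exact: emeasurable_funM.
- apply: measurableT_comp => //; apply/measurable_EFinP.
  exact: measurable_funM.
- apply: filterS2 aF aG => x /= /(_ I) F1 /(_ I) G1 _.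
  by rewrite -F1 -G1 -EFinM.
Qed.

(** Monotone convergence carries the uniform bound from the increasing [Gn] to anything below their
    supremum. *)
Lemma Lnorm_sup_le p G (Gn : nat -> T -> \bar R) (C : \bar R) : (0 < p)%R ->
  measurable_fun setT G -> (forall n, measurable_fun setT (Gn n)) ->
  (forall n x, 0 <= Gn n x) ->
  (forall x, {homo Gn^~ x : m n / (m <= n)%N >-> m <= n}) ->
  (forall x, 0 <= G x <= ereal_sup (range (Gn^~ x))) ->
  0 <= C -> (forall n, 'N[mu]_p%:E[Gn n] <= C) -> 'N[mu]_p%:E[G] <= C.
Proof.
move=> p0 mG mGn Gn0 ndG GGn C0 GnC; apply: Lnorm_le_pow => //.
pose g n x := `|Gn n x| `^ p.
have g0 n x : setT x -> 0 <= g n x by rewrite poweR_ge0.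
have mg n : measurable_fun setT (g n) by exact: measurable_abse_poweR.
have ndg x : setT x -> {homo g^~ x : m n / (m <= n)%N >-> m <= n}.
  move=> _ m n mn; apply: le_poweR => //; first exact: ltW.
  by rewrite !gee0_abs//; exact: ndG.
apply: (@le_trans _ _ (\int[mu]_x limn (g^~ x))).
  apply: ge0_le_integral => //.
  - by move=> x _; exact: poweR_ge0.
  - exact: measurable_abse_poweR.
  - apply: (@emeasurable_fun_cvg _ _ _ _ g) => // x _.
    exact: ereal_nondecreasing_is_cvgn (ndg x I).
  - move=> x _; have /cvg_lim -> // := ereal_nondecreasing_cvgn (ndg x I).
    set s := ereal_sup _.
    have s0 : 0 <= s.
      by apply: ereal_sup_ge; exists (g 0%N x); rewrite ?poweR_ge0//; exists 0%N.
    (* Taking [p]-th roots, it remains to bound [G x] by the root of [s], which dominates every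
       [Gn n x]. *)
    rewrite [leRHS](_ : s = (s `^ p^-1) `^ p); last first.
      by rewrite -poweRrM mulVf ?gt_eqF// poweRe1.
    have /andP[G0 Gs] := GGn x.
    apply: le_poweR => //; first exact: ltW.
    rewrite gee0_abs//; apply: (le_trans Gs); apply: ge_ereal_sup => _ [n _ <-].
    rewrite [leLHS](_ : _ = (g n x) `^ p^-1); last first.
      by rewrite /g -poweRrM mulfV ?gt_eqF// poweRe1// gee0_abs.
    apply: le_poweR; rewrite ?invr_ge0 ?(ltW p0) ?poweR_ge0//.
    by apply: ereal_sup_ubound; exists n.
rewrite monotone_convergence//; apply: lime_le.
  apply: ereal_nondecreasing_is_cvgn => m n mn.
  apply: ge0_le_integral; [exact: measurableT|exact: (g0 m)|exact: mg|exact: mg|].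
  by move=> x xT; exact: (ndg x xT).
by apply: nearW => n; exact: int_pow_le.
Qed.

Lemma conj_mul p q : (0 < p)%R -> (0 < q)%R -> (p^-1 + q^-1 = 1)%R ->
  ((p - 1) * q = p)%R.
Proof.
move=> p0 q0 pq; have E : (q + p = p * q)%R.
  rewrite -[RHS]mulr1 -pq mulrDr (mulrC p q) mulfK ?gt_eqF//.
  by rewrite (mulrC q p) mulfK ?gt_eqF.
by rewrite mulrBl mul1r -E addrC addKr.
Qed.

(** For [r > 0], divide by [r^(1/p)] and use [1 - 1/p = 1/q]. *)
Lemma conj_absorb (r C p q : R) : (0 < p)%R -> (0 < q)%R ->
  (p^-1 + q^-1 = 1)%R -> (0 <= r)%R -> (0 <= C)%R ->
  (r <= C * r `^ p^-1)%R -> (r `^ q^-1 <= C)%R.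
Proof.
move=> p0 q0 pq r0 C0 rC; move: r0; rewrite le_eqVlt => /predU1P[<-|r0].
  by rewrite powR0 // gt_eqF ?invr_gt0.
have rp : (0 < r `^ p^-1)%R by rewrite powR_gt0.
rewrite -(ler_pM2l rp) -powRD ?pq ?powRr1 ?(ltW r0)//.
  by rewrite mulrC.
by apply/implyP => _; rewrite gt_eqF.
Qed.

(* [h] is tested against the powers [g_n ^ (q - 1)] of its bounded truncations
   [g_n], supported in [A n]; the integral of [g_n ^ q] is then finite and
   absorbs into itself. *)
Lemma converse_hoelder p q (h : T -> \bar R) (A : nat -> set T) (C : R) :
  (0 < p)%R -> (0 < q)%R -> (p^-1 + q^-1 = 1)%R ->
  measurable_fun setT h -> (forall x, 0 <= h x) ->
  (forall n, measurable (A n)) -> (forall n, mu (A n) < +oo) ->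
  {homo A : m n / (m <= n)%N >-> m `<=` n} ->
  (forall x, h x != 0 -> exists n, A n x) -> (0 <= C)%R ->
  (forall f : T -> R, measurable_fun setT f -> (forall x, (0 <= f x)%R) ->
     'N[mu]_p%:E[EFin \o f] < +oo ->
     \int[mu]_x (h x * (f x)%:E) <= C%:E * 'N[mu]_p%:E[EFin \o f]) ->
  'N[mu]_q%:E[h] <= C%:E.
Proof.
move=> p0 q0 pq mh h0 mA Afin ndA hA C0 hf.
have q1 : (0 < q - 1)%R.
  have : (q^-1 < 1)%R by rewrite -pq ltrDr invr_gt0.
  by rewrite invf_lt1// subr_gt0.
have qp : ((q - 1) * p = q)%R by apply: conj_mul => //; rewrite addrC.
pose m n x := mine (h x) n%:R%:E.
have m0 n x : 0 <= m n x by rewrite /m le_min h0/= lee_fin.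
have mfin n x : m n x \is a fin_num.
  by rewrite ge0_fin_numE// gt_min ltry orbT.
pose g n x := (fine (m n x) * \1_(A n) x)%R.
have g0 n x : (0 <= g n x)%R by rewrite mulr_ge0// fine_ge0.
have gh n x : (g n x)%:E <= h x.
  rewrite /g indicE; case: (_ \in _); rewrite ?mulr1 ?mulr0//.
  by rewrite fineK// ge_min lexx.
have gA n x : (g n x <= n%:R * \1_(A n) x)%R.
  by rewrite ler_wpM2r// -lee_fin fineK// ge_min lexx orbT.
have mg n : measurable_fun setT (g n).
  apply: measurable_funM; last exact: measurable_indic.
  by apply: measurable_fine_comp; exact: measurable_mine.
have mgE n : measurable_fun setT (EFin \o g n) by exact/measurable_EFinP.
have gq n : \int[mu]_x `|(g n x)%:E| `^ q = \int[mu]_x (g n x `^ q)%:E.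
  by apply: eq_integral => x _; rewrite gee0_abs ?lee_fin// poweR_EFin.
have gqfin n : \int[mu]_x (g n x `^ q)%:E < +oo.
  apply: (@le_lt_trans _ _ (\int[mu]_x ((n%:R `^ q)%:E * (\1_(A n) x)%:E))).
    apply: ge0_le_integral => //.
    - by move=> x _; rewrite lee_fin powR_ge0.
    - apply/measurable_EFinP; apply: (measurableT_comp (measurable_powR q)).
      exact: mg.
    - apply: measurable_funeM; apply/measurable_EFinP; exact: measurable_indic.
    - move=> x _; rewrite -EFinM lee_fin.
      apply: (@le_trans _ _ ((n%:R * \1_(A n) x) `^ q)%R).
        apply: ge0_ler_powR; [exact: ltW| | |exact: gA].
          by rewrite nnegrE.
        by rewrite nnegrE mulr_ge0.
      rewrite indicE; case: (_ \in _); rewrite ?mulr1 ?mulr0// powR0//.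
      by rewrite gt_eqF.
  rewrite ge0_integralZl_EFin ?powR_ge0//; last first.
    by apply/measurable_EFinP; exact: measurable_indic.
  by rewrite integral_indic// setIT lte_mul_pinfty ?lee_fin ?powR_ge0.
apply: (@Lnorm_sup_le q h (fun n => EFin \o g n)) => //.
- move=> x a b ab; rewrite /= lee_fin; apply: ler_pM; rewrite ?fine_ge0//.
    rewrite -lee_fin !fineK// /m le_min !ge_min lexx/= lee_fin ler_nat.
    by rewrite ab orbT.
  rewrite !indicE; have [xa|] := boolP (x \in A a); last by rewrite ler0n.
  suff -> : x \in A b by [].
  by apply/mem_set/(ndA _ _ ab)/set_mem.
- move=> x; rewrite h0/=; have [->|hx0] := eqVneq (h x) 0.
    by apply: ereal_sup_ge; exists (g 0%N x)%:E; [exists 0%N|rewrite lee_fin].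
  have [k Akx] := hA _ hx0.
  have gE n : (k <= n)%N -> (g n x)%:E = m n x.
    move=> kn; rewrite /g indicE mem_set ?mulr1 ?fineK//.
    exact: ndA kn _ Akx.
  (* Where [h] is infinite the truncations equal [n] from [k] on, hence are unbounded; where it is
     finite they eventually equal [h x]. *)
  have [hxy|hxfin] := eqVneq (h x) +oo.
    rewrite hxy leye_eq; apply/eqP/eqyP => r r0.
    pose n := maxn k (Num.truncn r).+1.
    apply: (@le_trans _ _ (g n x)%:E); last first.
      by apply: ereal_sup_ubound; exists n.
    rewrite gE ?leq_maxl// /m hxy min_r ?leey// lee_fin.
    apply: (@le_trans _ _ (Num.truncn r).+1%:R).
      exact/ltW/truncnS_gt.
    by rewrite ler_nat leq_maxr.
  have hfin : h x \is a fin_num by rewrite ge0_fin_numE// lt_neqAle hxfin leey.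
  pose n := maxn k (Num.truncn (fine (h x))).+1.
  apply: ereal_sup_ge; exists (g n x)%:E; first by exists n.
  rewrite gE ?leq_maxl// /m le_min lexx/= -[h x]fineK// lee_fin.
  apply: (@le_trans _ _ (Num.truncn (fine (h x))).+1%:R).
    exact/ltW/truncnS_gt.
  by rewrite ler_nat leq_maxr.
- move=> n; rewrite LnormE /= gq.
  set I := \int[mu]_x _.
  have I0 : 0 <= I by apply: integral_ge0 => x _; rewrite lee_fin powR_ge0.
  have Ifin : I \is a fin_num by rewrite ge0_fin_numE//; exact: gqfin.
  (* Since [(q - 1) p = q], this test function has [L^p] norm [I^(1/p)]. *)
  pose f x := (g n x `^ (q - 1))%R.
  have mf : measurable_fun setT f.
    by apply: (measurableT_comp (measurable_powR (q - 1))); exact: mg.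
  have f0 x : (0 <= f x)%R by exact: powR_ge0.
  have fp : \int[mu]_x `|(EFin \o f) x| `^ p = I.
    apply: eq_integral => x _ /=; rewrite ger0_norm ?f0// ?poweR_EFin.
    by rewrite /f -powRrM qp.
  have Nf : 'N[mu]_p%:E[EFin \o f] = I `^ p^-1 by rewrite LnormE fp.
  have Nfoo : 'N[mu]_p%:E[EFin \o f] < +oo.
    by rewrite Nf poweR_lty//; exact: gqfin.
  have : I <= C%:E * I `^ p^-1.
    rewrite -Nf; apply: le_trans (hf f mf f0 Nfoo).
    apply: ge0_le_integral => //.
    - by move=> x _; rewrite lee_fin powR_ge0.
    - apply/measurable_EFinP; apply: (measurableT_comp (measurable_powR q)).
      exact: mg.
    - by apply: emeasurable_funM => //; exact/measurable_EFinP.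
    - move=> x _; rewrite -(mulr_powRB1 (g0 n x) q0) EFinM.
      by apply: lee_wpmul2r; [rewrite lee_fin powR_ge0|exact: gh].
  rewrite -(fineK Ifin) !poweR_EFin -EFinM !lee_fin => /conj_absorb; apply=> //.
  exact: fine_ge0.
Qed.

End Lnorm_extra.

(** * Sums and suprema over countable families *)

Section countable_operations.
Context {R : realType} {K : pointedType}.
Variable D : set K.
Hypothesis Dcount : countable D.

Lemma countable_range : D !=set0 -> exists e : nat -> K, D = range e.
Proof.
move=> [k0 Dk0]; have /pfcard_geP[D0|[e]] : (D #<= [set: nat])%card by [].
  by move: Dk0; rewrite D0.
by exists e; rewrite image_eq.
Qed.

(** One enumeration, valid for all [a] at once, turns sums over [D] into series, for which termwise
    integration is available. The predicate [P] accommodates finite [D]. *)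
Lemma countable_esum_series : exists (P : pred nat) (e : nat -> K),
  (forall n, P n -> D (e n)) /\
  forall a : K -> \bar R, (forall k, D k -> 0 <= a k) ->
    \esum_(k in D) a k = \sum_(n <oo | P n) a (e n).
Proof.
have /countable_bijP[B] := Dcount.
rewrite card_eq_sym => /card_set_bijP[e eB].
exists (fun n => n \in B), e; split.
  by move=> n /set_mem Bn; case: eB => eBD _ _; exact: eBD.
move=> a a0; rewrite (reindex_esum B D e)// nneseries_esum.
  by congr (esum _ _); apply/seteqP; split => n /=; rewrite inE.
by move=> n /set_mem Bn; apply: a0; case: eB => eBD _ _; exact: eBD.
Qed.

Lemma ge0_esumZl (a : K -> \bar R) (x : R) : (forall k, D k -> 0 <= a k) ->
  (0 <= x)%R -> \esum_(k in D) (x%:E * a k) = x%:E * \esum_(k in D) a k.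
Proof.
move=> a0 x0; have [P [e [PD E]]] := countable_esum_series.
rewrite !E//; last by move=> k Dk; rewrite mule_ge0 ?a0.
by rewrite nneseriesZl// => n Pn; exact/a0/PD.
Qed.

Context {d : measure_display} {T : measurableType d}.
Variable mu : {measure set T -> \bar R}.
Variable f : K -> T -> \bar R.
Hypothesis mf : forall k, D k -> measurable_fun setT (f k).
Hypothesis f0 : forall k x, D k -> 0 <= f k x.

Lemma measurable_esum : measurable_fun setT (fun x => \esum_(k in D) f k x).
Proof.
have [P [e [PD E]]] := countable_esum_series.
rewrite [X in measurable_fun _ X](_ : _ =
    fun x => \sum_(n <oo | n \in P) f (e n) x); last first.
  by apply/funext => x; rewrite E// => k Dk; exact: f0.
apply: ge0_emeasurable_sum => [n x _ Pn|n Pn]; first exact/f0/PD.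
exact/mf/PD.
Qed.

Lemma integral_esum (A : set T) : measurable A ->
  \int[mu]_(x in A) (\esum_(k in D) f k x)
    = \esum_(k in D) \int[mu]_(x in A) f k x.
Proof.
move=> mA; have [P [e [PD E]]] := countable_esum_series.
rewrite E; last by move=> k Dk; apply: integral_ge0 => x _; exact: f0.
rewrite (eq_integral (fun x => \sum_(n <oo) if P n then f (e n) x else 0));
  last by move=> x _; rewrite E ?eseries_mkcond// => k Dk; exact: f0.
rewrite integral_nneseries//.
- by rewrite [RHS]eseries_mkcond; apply: eq_eseriesr => n _;
    case: ifPn => // _; rewrite integral0.
- move=> n; have [Pn|_] := boolP (P n); last exact: measurable_cst.
  by apply: measurable_funTS; exact: mf (PD _ Pn).
- by move=> n x _; case: ifPn => // Pn; exact/f0/PD.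
Qed.

Lemma measurable_esup : D !=set0 ->
  measurable_fun setT (fun x => ereal_sup [set f k x | k in D]).
Proof.
move=> /countable_range[e DE].
rewrite [X in measurable_fun _ X](_ : _ =
    fun x => esups (fun n => f (e n) x) 0%N).
  by apply: measurable_fun_esups => n; apply: mf; rewrite DE; exists n.
apply/funext => x; rewrite /esups; congr ereal_sup; rewrite DE.
apply/seteqP; split => [_ [_ [n _ <-] <-]|_ [n _ <-]]; first by exists n.
by exists (e n) => //; exists n.
Qed.

End countable_operations.

(** * Averages and maximal functions over nested families *)

(** [average] for extended-real functions, so that maximal functions and values of the operator can
    be averaged too. *)
Definition eavg {d} {T : measurableType d} {R : realType}
    (mu : {measure set T -> \bar R}) (F : T -> \bar R) (Q : set T) : \bar R :=
  (\int[mu]_(x in Q) `|F x|) / mu Q.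

(** [sumop] and [supop] are the dyadic sum and supremum over an abstract family [D]. Of the dyadic
    cubes the argument uses only that they form a nonempty countable nested family of measurable
    sets of finite measure. *)
Definition sumop {T : Type} {R : realType} (D : set (set T))
    (a : set T -> \bar R) (x : T) : \bar R :=
  \esum_(Q in D) (a Q * (\1_Q x)%:E).

Definition supop {T : Type} {R : realType} (D : set (set T))
    (a : set T -> \bar R) (x : T) : \bar R :=
  ereal_sup [set a Q * (\1_Q x)%:E | Q in D].

Definition nested {T : Type} (D : set (set T)) :=
  forall Q S, D Q -> D S -> [\/ Q `<=` S, S `<=` Q | Q `&` S = set0].

Section integral_seq.
Context {d : measure_display} {T : measurableType d} {R : realType}.
Variables (mu : {measure set T -> \bar R}) (I : eqType) (s : seq I).
Variable f : I -> T -> \bar R.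
Hypothesis mf : {in s, forall k, measurable_fun setT (f k)}.
Hypothesis f0 : {in s, forall k x, 0 <= f k x}.

Lemma emeasurable_sum_in : measurable_fun setT (fun x => \sum_(k <- s) f k x).
Proof.
rewrite (_ : (fun x => _) =
    fun x => \sum_(k <- s) (if k \in s then f k x else 0)); last first.
  by apply/funext => x; rewrite big_seq big_mkcond.
apply: emeasurable_sum => k; have [ks|_] := boolP (k \in s); first exact: mf.
exact: measurable_cst.
Qed.

Lemma ge0_integral_sum_in :
  \int[mu]_x (\sum_(k <- s) f k x) = \sum_(k <- s) \int[mu]_x f k x.
Proof.
rewrite (eq_integral (fun x => \sum_(k <- s) (if k \in s then f k x else 0)));
  last by move=> x _; rewrite big_seq big_mkcond.
rewrite ge0_integral_sum//.
- rewrite [RHS]big_seq [RHS]big_mkcond; apply: eq_bigr => k _.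
  by case: (k \in s) => //; rewrite integral0.
- by move=> k; have [ks|_] := boolP (k \in s); [exact: mf|exact: measurable_cst].
- by move=> k x _; case: ifPn => // ks; exact: f0.
Qed.

End integral_seq.

(** * Doob's inequality for finite nested families *)

Section maximal.
Context {d : measure_display} {T : measurableType d} {R : realType}.
Variables (mu : {measure set T -> \bar R}) (D : set (set T)).
Hypothesis Dmeas : forall Q, D Q -> measurable Q.
Hypothesis Dnest : nested D.
Hypothesis mufin : forall Q, D Q -> mu Q < +oo.
Implicit Types (F : T -> \bar R) (p q : R).

Lemma integral_indicl F Q : measurable Q ->
  \int[mu]_x (F x * (\1_Q x)%:E) = \int[mu]_(x in Q) F x.
Proof.
by move=> mQ; rewrite [RHS]integral_mkcond epatch_indic.
Qed.

(** Pointwise [|F| <= 1 + |F|^p], and [Q] has finite measure. *)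
Lemma int_cube_fin p F Q : (1 <= p)%R -> measurable_fun setT F ->
  'N[mu]_p%:E[F] < +oo -> D Q -> \int[mu]_(x in Q) `|F x| \is a fin_num.
Proof.
move=> p1 mF Foo DQ; have p0 : (0 < p)%R by exact: lt_le_trans p1.
have mQ := Dmeas DQ; rewrite ge0_fin_numE ?integral_ge0//.
apply: (@le_lt_trans _ _ (\int[mu]_(x in Q) (cst 1 x + `|F x| `^ p))).
  apply: ge0_le_integral => //.
  - by apply: measurable_funTS; exact: measurableT_comp.
  - apply: emeasurable_funD; first exact: measurable_cst.
    by apply: measurable_funTS; exact: measurable_abse_poweR.
  - move=> x _; case: (F x) => [y| |]/=.
    + rewrite lee_fin; have [y1|y1] := leP `|y|%R 1%R.
        by rewrite (le_trans y1)// lerDl powR_ge0.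
      apply: (@le_trans _ _ (`|y| `^ p)%R); last by rewrite lerDr.
      by rewrite -[leLHS]powRr1// ler_powR// ltW.
    + by rewrite gt_eqF// addey.
    + by rewrite gt_eqF// addey.
rewrite ge0_integralD//; first last.
- by apply: measurable_funTS; exact: measurable_abse_poweR.
- by move=> x _; exact: poweR_ge0.
rewrite integral_cst// mul1e lte_add_pinfty ?mufin//.
apply: le_lt_trans (Lnorm_lty p0 Foo).
apply: ge0_subset_integral => //; first exact: measurable_abse_poweR.
by move=> x _; exact: poweR_ge0.
Qed.

Lemma eavg_ge0 F Q : 0 <= eavg mu F Q.
Proof. by rewrite mule_ge0 ?integral_ge0// inve_ge0. Qed.

Lemma int_null F Q : measurable_fun setT F -> measurable Q -> mu Q = 0 ->
  \int[mu]_(x in Q) F x = 0.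
Proof.
by move=> mF mQ Q0; apply: null_set_integral => //; exact: measurable_funTS.
Qed.

Section Lp_function.
Variables (p : R) (F : T -> \bar R).
Hypotheses (p1 : (1 <= p)%R) (mF : measurable_fun setT F).
Hypothesis Foo : 'N[mu]_p%:E[F] < +oo.

Let mabsF : measurable_fun setT (fun x => `|F x|).
Proof. exact: measurableT_comp. Qed.

Lemma eavgM Q : D Q -> eavg mu F Q * mu Q = \int[mu]_(x in Q) `|F x|.
Proof.
move=> DQ; rewrite /eavg; have [Q0|Q0] := eqVneq (mu Q) 0.
  by rewrite Q0 mule0 int_null//; exact: Dmeas.
rewrite -muleA mulVe ?mule1//.
by rewrite ge0_fin_numE ?mufin.
Qed.

Lemma eavg_fin Q : D Q -> eavg mu F Q \is a fin_num.
Proof.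
move=> DQ; have Ifin := int_cube_fin p1 mF Foo DQ.
rewrite /eavg; have [Q0|Q0] := eqVneq (mu Q) 0.
  by rewrite int_null ?mul0e//; exact: Dmeas.
by rewrite fin_numM// fin_numV// ?gt_eqF// (lt_le_trans _ (measure_ge0 _ _)).
Qed.

End Lp_function.

Definition finmax (s : seq (set T)) (u : set T -> R) (x : T) : R :=
  \big[Order.max/0%R]_(Q <- s | x \in Q) u Q.

Section finite_subfamily.
Variables (s : seq (set T)) (u : set T -> R).
Hypotheses (us : uniq s) (sD : {in s, forall Q, D Q}).

(** Members of [s] containing [x] meet each other, so nestedness makes them a chain, and a set
    containing one of them contains [x]. *)
Lemma finmax_telescope (phi : R -> R) x :
  (\sum_(Q <- s | x \in Q) (phi (maxge u s Q) - phi (maxgt u s Q))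
     = phi (finmax s u x) - phi 0)%R.
Proof.
apply: (telescope_max (fun a _ => phi a) u u us).
  by move=> Q /set_mem Qx S; rewrite subsetEset => QS; exact/mem_set/QS.
move=> Q S; rewrite !inE => /andP[Qs Qx] /andP[Ss Sx].
have [QS|SQ|QS0] := Dnest (sD Qs) (sD Ss).
- by apply/orP; left; rewrite subsetEset.
- by apply/orP; right; rewrite subsetEset.
- suff : set0 x by [].
  by rewrite -QS0; split; exact/set_mem.
Qed.

Lemma finmax_ge0 x : (0 <= finmax s u x)%R.
Proof. exact: bigmax_ge_id. Qed.

Lemma finmaxE x :
  (finmax s u x = \sum_(Q <- s) (maxge u s Q - maxgt u s Q) * \1_Q x)%R.
Proof.
rewrite -[LHS](subr0) -(finmax_telescope id) big_mkcond/=.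
by apply: eq_bigr => Q _; rewrite indicE; case: (_ \in _); rewrite ?mulr1 ?mulr0.
Qed.

Lemma measurable_finmax : measurable_fun setT (finmax s u).
Proof.
rewrite (_ : finmax s u = fun x => (\sum_(Q <- s)
    (if Q \in s then (maxge u s Q - maxgt u s Q) * \1_Q x else 0))%R); last first.
  by apply/funext => x; rewrite finmaxE big_seq big_mkcond.
apply: measurable_sum => Q; have [Qs|_] := boolP (Q \in s); last first.
  exact: measurable_cst.
by apply: measurable_funM => //; apply: measurable_indic; exact/Dmeas/sD.
Qed.

(* By Young's inequality [c b^(p - 1) <= c^p / p + b^p / q]. *)
Lemma doob_step p q (a b c : R) : (1 < p)%R -> (0 < q)%R ->
  (p^-1 + q^-1 = 1)%R -> (0 <= c)%R -> (0 <= b)%R -> a = Num.max c b ->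
  (a `^ p - b `^ p <= q * (c * (a `^ (p - 1) - b `^ (p - 1))))%R.
Proof.
move=> p1 q0 pq c0 b0 ->; have [cb|bc] := leP c b.
  by rewrite !subrr !mulr0.
have p0 : (0 < p)%R by exact: lt_trans p1.
have pqM := conj_mul p0 q0 pq.
have := conjugate_powR c0 (powR_ge0 b (p - 1)) p0 q0 pq.
rewrite -powRrM pqM => Y.
have {Y}Y : (q * (c * b `^ (p - 1)) <= (q - 1) * c `^ p + b `^ p)%R.
  apply: le_trans (ler_wpM2l (ltW q0) Y) _.
  rewrite mulrDr (mulrC q (b `^ p / q)%R) divfK ?gt_eqF// lerD2r.
  rewrite mulrCA mulrC ler_wpM2r ?powR_ge0//.
  by rewrite (_ : p^-1 = 1 - q^-1)%R ?mulrBr ?mulr1 ?divff ?gt_eqF// -pq addrK.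
rewrite mulrBr mulr_powRB1//.
lra.
Qed.

End finite_subfamily.

(** Telescoping [M^p] and applying [doob_step] to each increment bounds it by [q] times the sum of
    [u Q * dl Q] over the [Q] containing the point, [dl] being the increments of [M^(p-1)]. As
    [u Q * mu Q] is the integral of [|F|] over [Q], the integral [I] of [M^p] is at most [q] times
    that of [|F| M^(p-1)]. Hölder then gives a factor [I^(1/q)], which is absorbed. *)
Lemma doob_finite p q F s : (1 < p)%R -> (0 < q)%R -> (p^-1 + q^-1 = 1)%R ->
  measurable_fun setT F -> 'N[mu]_p%:E[F] < +oo ->
  uniq s -> {in s, forall Q, D Q} ->
  'N[mu]_p%:E[EFin \o finmax s (fun Q => fine (eavg mu F Q))]
    <= q%:E * 'N[mu]_p%:E[F].
Proof.
move=> p1 q0 pq mF Foo us sD; have p0 : (0 < p)%R by exact: lt_trans p1.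
set u := fun Q => fine _; set M := finmax s u.
have u0 Q : (0 <= u Q)%R by rewrite fine_ge0// eavg_ge0.
have uE Q : D Q -> (u Q)%:E * mu Q = \int[mu]_(x in Q) `|F x|.
  move=> DQ; rewrite fineK ?(eavgM mF)//.
  exact: (eavg_fin (ltW p1)).
pose dl Q := (maxge u s Q `^ (p - 1) - maxgt u s Q `^ (p - 1))%R.
have dl0 Q : (0 <= dl Q)%R.
  rewrite subr_ge0; apply: ge0_ler_powR.
  - by rewrite subr_ge0 ltW.
  - by rewrite nnegrE maxgt_ge0.
  - by rewrite nnegrE maxge_ge0.
  - exact: maxgt_le_maxge.
have mM : measurable_fun setT M by exact: measurable_finmax.
have M0 x : (0 <= M x)%R by exact: finmax_ge0.
have absF0 x : 0 <= `|F x| by [].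
have mabsF : measurable_fun setT (fun x => `|F x|) by exact: measurableT_comp.
have m1 Q : Q \in s -> measurable_fun setT (fun x : T => (\1_Q x : R)%:E).
  by move=> Qs; apply/measurable_EFinP/measurable_indic/Dmeas/sD.
have i0 Q (x : T) : 0 <= (\1_Q x : R)%:E by rewrite lee_fin.
have MpE x : (M x `^ (p - 1))%:E = \sum_(Q <- s) ((dl Q)%:E * (\1_Q x)%:E).
  rewrite sumEFin.
  have := finmax_telescope u us sD (fun a => a `^ (p - 1))%R x.
  rewrite powR0 ?subr_eq0 ?gt_eqF// subr0 big_mkcond/= => <-.
  congr EFin; apply: eq_bigr => Q _.
  by rewrite indicE; case: (_ \in _); rewrite ?mulr1 ?mulr0.
have Mp x : (M x `^ p)%:E
    <= \sum_(Q <- s) ((q * (u Q * dl Q))%:E * (\1_Q x)%:E).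
  have := finmax_telescope u us sD (fun a => a `^ p)%R x.
  rewrite powR0 ?gt_eqF// subr0 => <-; rewrite sumEFin lee_fin.
  rewrite big_mkcond big_seq [leRHS]big_seq/=; apply: ler_sum => Q Qs.
  rewrite indicE; case: (_ \in _); rewrite ?mulr1 ?mulr0//.
  by apply: doob_step => //; [exact: maxgt_ge0|exact: maxgeE].
set I := \int[mu]_x (M x `^ p)%:E.
have I0 : 0 <= I by apply: integral_ge0 => x _; rewrite lee_fin powR_ge0.
have mMp r : measurable_fun setT (fun x => (M x `^ r)%:E).
  apply/measurable_EFinP; apply: (measurableT_comp (measurable_powR r)).
  exact: mM.
have I1 : I <= \sum_(Q <- s) ((q * dl Q)%:E * \int[mu]_(x in Q) `|F x|).
  apply: (@le_trans _ _ (\int[mu]_x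
      \sum_(Q <- s) ((q * (u Q * dl Q))%:E * (\1_Q x)%:E))).
    apply: ge0_le_integral => //.
    - by move=> x _; rewrite lee_fin powR_ge0.
    - by apply: emeasurable_sum_in => Q Qs; apply: measurable_funeM; exact: m1.
  rewrite ge0_integral_sum_in; first last.
  - by move=> Q Qs x; rewrite mule_ge0// lee_fin !mulr_ge0// ltW.
  - by move=> Q Qs; apply: measurable_funeM; exact: m1.
  rewrite big_seq [leRHS]big_seq; apply: lee_sum => Q Qs.
  rewrite ge0_integralZl_EFin ?mulr_ge0 ?(ltW q0)//; last exact: m1.
  rewrite integral_indic ?setIT//; last exact/Dmeas/sD.
  by rewrite -(uE _ (sD _ Qs)) muleA -EFinM mulrA mulrAC.
(* Absorption requires [I] to be finite; it is bounded by a finite sum of finite integrals. *)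
have Ifin : I \is a fin_num.
  rewrite ge0_fin_numE//; apply: (le_lt_trans I1).
  rewrite big_seq; apply: lte_sum_pinfty => Q Qs.
  by rewrite ltey_eq fin_numM// (int_cube_fin (ltW p1) mF Foo (sD _ Qs)).
(* Under the integral the increments [dl] add up again to [M^(p-1)]. *)
have I2 : I <= q%:E * \int[mu]_x `|F x * (M x `^ (p - 1))%:E|.
  apply: (le_trans I1); rewrite le_eqVlt; apply/orP; left; apply/eqP.
  rewrite (eq_integral (fun x =>
      \sum_(Q <- s) ((dl Q)%:E * (`|F x| * (\1_Q x)%:E)))); last first.
    move=> x _; rewrite abseM (@gee0_abs _ (_%:E)) ?lee_fin ?powR_ge0// MpE.
    rewrite ge0_sume_distrr; last by move=> Q _; rewrite mule_ge0 ?lee_fin ?dl0.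
    by apply: eq_bigr => Q _; rewrite muleCA.
  have mFQ Q : Q \in s -> measurable_fun setT (fun x => `|F x| * (\1_Q x)%:E).
    by move=> Qs; apply: emeasurable_funM => //; exact: m1.
  rewrite ge0_integral_sum_in; first last.
  - by move=> Q Qs x; rewrite !mule_ge0 ?lee_fin ?dl0.
  - by move=> Q Qs; apply: measurable_funeM; exact: mFQ.
  rewrite ge0_sume_distrr; last first.
    by move=> Q _; apply: integral_ge0 => x _; rewrite !mule_ge0 ?lee_fin ?dl0.
  rewrite [LHS]big_seq [RHS]big_seq; apply: eq_bigr => Q Qs.
  rewrite (@ge0_integralZl_EFin _ _ _ mu setT measurableT
    (fun x => `|F x| * (\1_Q x)%:E)) ?dl0//; last exact: mFQ.
  by rewrite integral_indicl ?muleA; last exact/Dmeas/sD.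
have NqE : 'N[mu]_q%:E[(fun x => (M x `^ (p - 1))%:E)] = I `^ q^-1.
  rewrite LnormE; congr (_ `^ _); apply: eq_integral => x _.
  rewrite gee0_abs ?lee_fin ?powR_ge0// poweR_EFin -powRrM.
  by rewrite conj_mul.
have NpE : 'N[mu]_p%:E[EFin \o M] = I `^ p^-1.
  rewrite LnormE; congr (_ `^ _); apply: eq_integral => x _ /=.
  by rewrite ger0_norm.
have H := ehoelder p0 q0 pq mF (mMp (p - 1)%R) Foo.
have Ioo : I < +oo by rewrite ltey_eq Ifin.
rewrite NqE in H; have {}H := H (poweR_lty _ Ioo).
rewrite NpE.
have Nfin : 'N[mu]_p%:E[F] \is a fin_num.
  by rewrite ge0_fin_numE; [exact: Foo|exact: Lnorm_ge0].
have : I <= (q%:E * 'N[mu]_p%:E[F]) * I `^ q^-1.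
  rewrite -muleA; apply: (le_trans I2); apply: lee_wpmul2l H.
  by rewrite lee_fin ltW.
rewrite -(fineK Ifin) -(fineK Nfin) !poweR_EFin -!EFinM !lee_fin.
apply: conj_absorb => //; first by rewrite addrC.
  exact: fine_ge0.
by rewrite mulr_ge0 ?(ltW q0) ?fine_ge0//; exact: Lnorm_ge0.
Qed.

End maximal.

(** * Sum and supremum operators over a countable family *)

Section countable_family.
Context {d : measure_display} {T : measurableType d} {R : realType}.
Variable D : set (set T).
Hypothesis Dcount : countable D.
Hypothesis Dne : D !=set0.
Hypothesis Dmeas : forall Q, D Q -> measurable Q.

Lemma measurable_cube_term (a : set T -> \bar R) Q : D Q ->
  measurable_fun setT (fun x => a Q * (\1_Q x)%:E).
Proof.
move=> DQ; apply: measurable_funeM.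
by apply/measurable_EFinP/measurable_indic/Dmeas.
Qed.

Lemma measurable_supop (a : set T -> \bar R) : measurable_fun setT (supop D a).
Proof.
apply: (measurable_esup Dcount (f := fun Q x => a Q * (\1_Q x)%:E)) => // Q.
exact: measurable_cube_term.
Qed.

Lemma measurable_sumop (a : set T -> \bar R) : (forall Q, D Q -> 0 <= a Q) ->
  measurable_fun setT (sumop D a).
Proof.
move=> a0; apply: (measurable_esum Dcount) => Q.
  exact: measurable_cube_term.
by move=> x DQ; rewrite mule_ge0 ?a0 ?lee_fin.
Qed.

Lemma le_supop (a : set T -> \bar R) Q x : D Q ->
  a Q * (\1_Q x)%:E <= supop D a x.
Proof. by move=> DQ; apply: ereal_sup_ubound; exists Q. Qed.

Lemma le_supop_mem (a : set T -> \bar R) Q x : D Q -> Q x -> a Q <= supop D a x.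
Proof.
move=> DQ Qx; apply: le_trans (le_supop a x DQ).
by rewrite indicE mem_set// mule1.
Qed.

Lemma supop_ge0 (a : set T -> \bar R) x :
  (forall Q, D Q -> 0 <= a Q) -> 0 <= supop D a x.
Proof.
case: Dne => Q DQ a0; apply: le_trans (le_supop a x DQ).
by rewrite mule_ge0 ?a0 ?lee_fin.
Qed.

Lemma sumop_ge0 (a : set T -> \bar R) x :
  (forall Q, D Q -> 0 <= a Q) -> 0 <= sumop D a x.
Proof. by move=> a0; apply: esum_ge0 => Q DQ; rewrite mule_ge0 ?a0 ?lee_fin. Qed.

(** [A n] is the union of the first [n] sets of an enumeration. Such sets support the truncations in
    [converse_hoelder]. *)
Lemma exhaustion (mu : {measure set T -> \bar R}) :
  (forall Q, D Q -> mu Q < +oo) ->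
  exists A : nat -> set T, [/\ forall n, measurable (A n),
    forall n, mu (A n) < +oo, {homo A : m n / (m <= n)%N >-> m `<=` n} &
    forall Q x, D Q -> Q x -> exists n, A n x].
Proof.
move=> mufin.
have [e De] : exists e : nat -> set T, D = range e by exact: countable_range.
have eD n : D (e n) by rewrite De; exists n.
exists (fun n => \big[setU/set0]_(i < n) e i); split.
- by move=> n; apply: bigsetU_measurable => i _; exact: Dmeas.
- elim=> [|n ih]; first by rewrite big_ord0 measure0.
  rewrite big_ord_recr/=; apply: le_lt_trans.
    apply: measureU2; last exact: Dmeas.
    by apply: bigsetU_measurable => i _; exact: Dmeas.
  by rewrite lte_add_pinfty// mufin.
- by move=> m n mn; apply: subset_bigsetU.
- move=> Q x; rewrite De => -[n _ <-] ex; exists n.+1.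
  by rewrite big_ord_recr/=; right.
Qed.

Lemma integral_sumop (mu : {measure set T -> \bar R}) (a : set T -> \bar R)
    (g : T -> R) : (forall Q, D Q -> 0 <= a Q) -> measurable_fun setT g ->
  \int[mu]_x (sumop D a x * `|(g x)%:E|)
    = \esum_(Q in D) (a Q * \int[mu]_(x in Q) `|(g x)%:E|).
Proof.
move=> a0 mg.
have mgE : measurable_fun setT (fun x => `|(g x)%:E|).
  by apply: measurableT_comp => //; exact/measurable_EFinP.
rewrite (eq_integral (fun x =>
    \esum_(Q in D) (a Q * (`|(g x)%:E| * (\1_Q x)%:E)))); last first.
  move=> x _; rewrite muleC -ge0_esumZl//.
    by apply: eq_esum => Q _; rewrite muleCA.
  by move=> Q DQ; rewrite mule_ge0 ?a0 ?lee_fin.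
have mgQ Q : D Q -> measurable_fun setT (fun x => `|(g x)%:E| * (\1_Q x)%:E).
  move=> DQ; apply: emeasurable_funM => //.
  by apply/measurable_EFinP/measurable_indic/Dmeas.
rewrite integral_esum//; first last.
- by move=> Q x DQ; rewrite !mule_ge0 ?a0 ?lee_fin.
- by move=> Q DQ; apply: measurable_funeM; exact: mgQ.
apply: eq_esum => Q DQ.
have gQ0 x : setT x -> 0 <= `|(g x)%:E| * (\1_Q x)%:E.
  by move=> _; rewrite mule_ge0 ?lee_fin.
rewrite (ge0_integralZl mu measurableT (mgQ _ DQ) gQ0 (a0 _ DQ)).
by rewrite integral_indicl//; exact: Dmeas.
Qed.

End countable_family.

Section maximal_theorem.
Context {d : measure_display} {T : measurableType d} {R : realType}.
Variables (mu : {measure set T -> \bar R}) (D : set (set T)).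
Hypothesis Dcount : countable D.
Hypothesis Dne : D !=set0.
Hypothesis Dmeas : forall Q, D Q -> measurable Q.
Hypothesis Dnest : nested D.
Hypothesis mufin : forall Q, D Q -> mu Q < +oo.
Variables p q : R.
Hypotheses (p1 : (1 < p)%R) (q0 : (0 < q)%R) (pq : (p^-1 + q^-1 = 1)%R).

Let p0 : (0 < p)%R. Proof. exact: lt_trans p1. Qed.

(** The first [n] sets of an enumeration give increasing finite maximal functions, bounded by
    [doob_finite] uniformly in [n]. *)
Lemma doob (F : T -> \bar R) : measurable_fun setT F ->
  'N[mu]_p%:E[supop D (eavg mu F)] <= q%:E * 'N[mu]_p%:E[F].
Proof.
move=> mF; have [Foo|] := ltP 'N[mu]_p%:E[F] +oo; last first.
  by rewrite leye_eq => /eqP ->; rewrite gt0_muley ?lte_fin// leey.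
have [e De] : exists e : nat -> set T, D = range e by exact: countable_range.
have eD n : D (e n) by rewrite De; exists n.
pose s n := undup [seq e i | i <- iota 0 n].
have sD n : {in s n, forall Q, D Q}.
  by move=> Q; rewrite mem_undup => /mapP[i _ ->].
pose u Q := fine (eavg mu F Q).
have ms n : measurable_fun setT (finmax (s n) u).
  by apply: (measurable_finmax (D := D)) => //; exact: undup_uniq.
apply: (@Lnorm_sup_le _ _ _ mu p _ (fun n => EFin \o finmax (s n) u)) => //.
- exact: measurable_supop.
- by move=> n; exact/measurable_EFinP.
- by move=> n x; rewrite /= lee_fin finmax_ge0.
- move=> x m n mn; rewrite /= lee_fin; apply: sub_bigmax_seq => Q.
  rewrite !mem_undup => /mapP[i]; rewrite mem_iota add0n => /andP[_ im] ->.
  by apply: map_f; rewrite mem_iota add0n (leq_trans im).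
- move=> x; rewrite supop_ge0//=; last by move=> Q _; exact: eavg_ge0.
  apply: ge_ereal_sup => _ [Q DQ <-]; move: (DQ); rewrite De => -[n _ eQ].
  rewrite -{}eQ in DQ *.
  apply: ereal_sup_ge; exists (finmax (s n.+1) u x)%:E; first by exists n.+1.
  rewrite indicE; have [xe|_] := boolP (x \in e n); last first.
    by rewrite mule0 lee_fin finmax_ge0.
  rewrite mule1 -[leLHS]fineK; last exact: (eavg_fin Dmeas mufin (ltW p1)).
  rewrite lee_fin -/(u (e n)); apply: le_bigmax_seq => //.
  by rewrite mem_undup map_f// mem_iota add0n ltnSn.
- by rewrite mule_ge0 ?lee_fin ?(ltW q0)//; exact: Lnorm_ge0.
- by move=> n; apply: (doob_finite Dmeas Dnest mufin) => //; exact: undup_uniq.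
Qed.

Lemma eavg_ge (G : T -> \bar R) Q (a : R) : measurable_fun setT G ->
  D Q -> mu Q != 0 -> (0 <= a)%R -> (forall x, Q x -> a%:E <= `|G x|) ->
  a%:E <= eavg mu G Q.
Proof.
move=> mG DQ Q0 a0 aG.
have Qfin : mu Q \is a fin_num by rewrite ge0_fin_numE// mufin.
rewrite /eavg -[leLHS]mule1 -(mulVe Q0 Qfin) (muleC _ (mu Q)) muleA.
apply: lee_wpmul2r; first by rewrite inve_ge0.
rewrite -integral_cst; last exact: Dmeas.
apply: ge0_le_integral => //; first exact: Dmeas.
by apply: measurable_funTS; exact: measurableT_comp.
Qed.

Lemma eavg_fine (G : T -> \bar R) Q : measurable_fun setT G ->
  'N[mu]_p%:E[G] < +oo -> D Q ->
  eavg mu (EFin \o (fine \o G)) Q = eavg mu G Q.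
Proof.
move=> mG Goo DQ; congr (_ / _); apply: ae_eq_integral.
- exact: Dmeas.
- apply: measurable_funTS; apply: measurableT_comp => //.
  by apply/measurable_EFinP; exact: measurable_fine_comp.
- by apply: measurable_funTS; exact: measurableT_comp.
- by apply: filterS (fine_Lnorm_ae p0 mG Goo) => x /= /(_ I) {2}<- _.
Qed.

(** The function [f] is the finite part of the maximal function, an admissible real test function.
    Averaging it over [Q] loses nothing almost everywhere, so a lower bound of the maximal function
    on [Q] bounds its average as well. *)
Lemma maximal_fine (F : T -> \bar R) : measurable_fun setT F ->
  'N[mu]_p%:E[F] < +oo -> exists f : T -> R,
  [/\ measurable_fun setT f,
      'N[mu]_p%:E[EFin \o f] <= q%:E * 'N[mu]_p%:E[F] &
      forall Q a, D Q -> mu Q != 0 -> (0 <= a)%R ->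
        (forall x, Q x -> a%:E <= supop D (eavg mu F) x) ->
        a%:E <= eavg mu (EFin \o f) Q].
Proof.
move=> mF Foo; set G := supop D (eavg mu F).
have mG : measurable_fun setT G by exact: measurable_supop.
have NG : 'N[mu]_p%:E[G] <= q%:E * 'N[mu]_p%:E[F] by exact: doob.
have Goo : 'N[mu]_p%:E[G] < +oo.
  by apply: (le_lt_trans NG); rewrite lte_mul_pinfty ?lee_fin ?(ltW q0).
have mf := measurable_fine_comp mG.
exists (fine \o G); split => //.
  rewrite (ae_eq_Lnorm _ _ mG (fine_Lnorm_ae p0 mG Goo))//.
  exact/measurable_EFinP.
move=> Q a DQ Q0 a0 aG; rewrite eavg_fine//; apply: eavg_ge => // x Qx.
apply: (le_trans (aG x Qx)).
exact: lee_abs.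
Qed.

End maximal_theorem.

(** * The bilinear form *)

Section bilinear.
Context {d : measure_display} {T : measurableType d} {R : realType}.
Variables (D : set (set T)) (kappa : set T -> R).
Implicit Types (sigma omega mu : {measure set T -> \bar R}) (C : R).

(* In the application [kappa Q = lambda Q * omega Q]. *)
Definition pairing sigma omega (F G : T -> \bar R) : \bar R :=
  \esum_(Q in D) ((kappa Q)%:E * eavg sigma F Q * eavg omega G Q).

Definition pairing_bounded sigma omega (p r C : R) := forall f g : T -> R,
  measurable_fun setT f -> measurable_fun setT g ->
  'N[sigma]_p%:E[EFin \o f] < +oo -> 'N[omega]_r%:E[EFin \o g] < +oo ->
  pairing sigma omega (EFin \o f) (EFin \o g)
    <= C%:E * ('N[sigma]_p%:E[EFin \o f] * 'N[omega]_r%:E[EFin \o g]).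

(** For [kappa Q = lambda Q * omega Q] this is the numerator of [Lambda]. It involves no measure and
    so serves both bounds in (ii). *)
Definition Ksum (Q : set T) : \bar R :=
  \esum_(S in [set S | D S /\ S `<=` Q]) (kappa S)%:E.

Lemma pairing_boundedC sigma omega p r C :
  pairing_bounded sigma omega p r C -> pairing_bounded omega sigma r p C.
Proof.
move=> H f g mf mg foo goo; rewrite (muleC 'N[omega]_r%:E[_]).
apply: le_trans (H g f mg mf goo foo).
rewrite le_eqVlt; apply/orP; left; apply/eqP.
by apply: eq_esum => Q _; rewrite muleAC.
Qed.

Hypothesis Dcount : countable D.
Hypothesis Dne : D !=set0.
Hypothesis Dmeas : forall Q, D Q -> measurable Q.
Hypothesis Dnest : nested D.
Hypothesis kappa0 : forall Q, D Q -> (0 <= kappa Q)%R.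

Lemma Ksum_ge0 Q : 0 <= Ksum Q.
Proof. by apply: esum_ge0 => S [DS _]; rewrite lee_fin kappa0. Qed.

Lemma Ksum_eq0 mu Q :
  (forall S, D S -> mu S = 0 -> kappa S = 0%R) ->
  D Q -> mu Q = 0 -> Ksum Q = 0.
Proof.
move=> k0 DQ Q0; apply: esum1 => S [DS SQ]; rewrite k0//.
by apply: subset_measure0 Q0 => //; exact: Dmeas.
Qed.

(** * Duality between the operator and the bilinear form *)

Section operator.
(** The coefficients [c] stay abstract because two choices occur, [lambda] and [kappa / omega],
    which may differ on [omega]-null cubes. *)
Variables (sigma omega : {measure set T -> \bar R}) (c : set T -> \bar R).
Hypothesis omegafin : forall Q, D Q -> omega Q < +oo.
Hypothesis c0 : forall Q, D Q -> 0 <= c Q.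
Hypothesis cE : forall Q, D Q -> c Q * omega Q = (kappa Q)%:E.
Variables p q r : R.
Hypotheses (q0 : (0 < q)%R) (r0 : (0 < r)%R) (qr : (q^-1 + r^-1 = 1)%R).

Let r1 : (1 <= r)%R.
Proof.
have : (r^-1 <= 1)%R by rewrite -qr lerDr invr_ge0 ltW.
by rewrite invf_le1.
Qed.

Let a0 F Q : D Q -> 0 <= c Q * eavg sigma F Q.
Proof. by move=> DQ; rewrite mule_ge0 ?c0 ?eavg_ge0. Qed.

Lemma pairing_sumop (F : T -> \bar R) (g : T -> R) : measurable_fun setT g ->
  'N[omega]_r%:E[EFin \o g] < +oo ->
  pairing sigma omega F (EFin \o g) =
  \int[omega]_x (sumop D (fun Q => c Q * eavg sigma F Q) x * `|(g x)%:E|).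
Proof.
move=> mg goo; rewrite integral_sumop//; last exact: a0.
have mgE : measurable_fun setT (EFin \o g) by exact/measurable_EFinP.
apply: eq_esum => Q DQ; rewrite -cE// -(eavgM Dmeas omegafin mgE DQ).
move: (eavg sigma F Q) (eavg omega _ Q) => x y.
by rewrite -!muleA; congr (_ * _); rewrite muleC -muleA.
Qed.

Lemma pairing_bounded_of_operator C : (0 <= C)%R ->
  (forall f : T -> R, measurable_fun setT f ->
    'N[omega]_q%:E[sumop D (fun Q => c Q * eavg sigma (EFin \o f) Q)]
      <= C%:E * 'N[sigma]_p%:E[EFin \o f]) ->
  pairing_bounded sigma omega p r C.
Proof.
move=> C0 H f g mf mg foo goo; rewrite pairing_sumop//.
set h := sumop D _; have mh : measurable_fun setT h.
  by apply: measurable_sumop => // Q; exact: a0.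
have h0 x : 0 <= h x by apply: sumop_ge0 => Q; exact: a0.
have mgE : measurable_fun setT (EFin \o g) by exact/measurable_EFinP.
have hoo : 'N[omega]_q%:E[h] < +oo.
  by apply: (le_lt_trans (H f mf)); rewrite lte_mul_pinfty ?lee_fin.
apply: (@le_trans _ _ ('N[omega]_q%:E[h] * 'N[omega]_r%:E[EFin \o g])).
  apply: le_trans (ehoelder q0 r0 qr mh mgE hoo goo).
  rewrite le_eqVlt; apply/orP; left; apply/eqP; apply: eq_integral => x _.
  by rewrite abseM (gee0_abs (h0 x)).
rewrite muleA; apply: lee_wpmul2r; first exact: Lnorm_ge0.
exact: H.
Qed.

(** By [pairing_sumop] the form tests [h] against [g], and [converse_hoelder] recovers the norm of
    [h], which vanishes outside the union of [D]. *)
Lemma operator_bounded_of_pairing C : (0 <= C)%R ->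
  pairing_bounded sigma omega p r C ->
  forall f : T -> R, measurable_fun setT f ->
    'N[sigma]_p%:E[EFin \o f] < +oo ->
    'N[omega]_q%:E[sumop D (fun Q => c Q * eavg sigma (EFin \o f) Q)]
      <= C%:E * 'N[sigma]_p%:E[EFin \o f].
Proof.
move=> C0 H f mf foo; set h := sumop D _.
have mh : measurable_fun setT h.
  by apply: measurable_sumop => // Q; exact: a0.
have h0 x : 0 <= h x by apply: sumop_ge0 => Q; exact: a0.
have Nfin : 'N[sigma]_p%:E[EFin \o f] \is a fin_num.
  by rewrite ge0_fin_numE; [exact: foo|exact: Lnorm_ge0].
have N0 : (0 <= fine 'N[sigma]_p%:E[EFin \o f])%R.
  by apply: fine_ge0; exact: Lnorm_ge0.
have [A [mA Afin ndA DA]] := exhaustion Dcount Dne Dmeas omegafin.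
rewrite -(fineK Nfin) -EFinM.
apply: (converse_hoelder r0 q0 _ mh h0 mA Afin ndA).
- by rewrite addrC.
- move=> x hx; have [Q [DQ Qx]] : exists Q, D Q /\ Q x.
    apply: contrapT => nQ; move/eqP: hx; apply; apply: esum1 => Q DQ.
    rewrite indicE memNset ?mule0// => Qx.
    by apply: nQ; exists Q.
  exact: DA Qx.
- by rewrite mulr_ge0.
- move=> g mg g0 goo; rewrite EFinM fineK// -muleA.
  apply: le_trans (H f g mf mg foo goo); rewrite pairing_sumop//.
  rewrite le_eqVlt; apply/orP; left; apply/eqP; apply: eq_integral => x _.
  by rewrite gee0_abs ?lee_fin.
Qed.

End operator.

(** * From the bilinear form to the maximal operators *)

Section maximal_of_pairing.
Variables (sigma omega : {measure set T -> \bar R}).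
Hypothesis sigmafin : forall Q, D Q -> sigma Q < +oo.
Hypothesis omegafin : forall Q, D Q -> omega Q < +oo.
Hypothesis ksigma : forall Q, D Q -> sigma Q = 0 -> kappa Q = 0%R.
Hypothesis komega : forall Q, D Q -> omega Q = 0 -> kappa Q = 0%R.
Variables p s q r : R.
Hypotheses (p1 : (1 < p)%R) (s0 : (0 < s)%R) (ps : (p^-1 + s^-1 = 1)%R).
Hypotheses (q1 : (1 < q)%R) (r0 : (0 < r)%R) (qr : (q^-1 + r^-1 = 1)%R).

(* [Ksum Q * <f>_Q] is at most the [omega]-integral over [Q] of the operator
   with coefficients [kappa / omega] applied to the maximal function [f1]. *)
Lemma maximal_bounded_of_pairing C : (0 <= C)%R ->
  pairing_bounded sigma omega p r C ->
  forall f : T -> R, measurable_fun setT f ->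
    'N[sigma]_p%:E[EFin \o f] < +oo ->
    'N[omega]_q%:E[supop D
        (fun Q => Ksum Q / omega Q * eavg sigma (EFin \o f) Q)]
      <= (r * C * s)%:E * 'N[sigma]_p%:E[EFin \o f].
Proof.
move=> C0 H f mf foo; have q0 : (0 < q)%R by exact: lt_trans q1.
have mfE : measurable_fun setT (EFin \o f) by exact/measurable_EFinP.
have [f1 [mf1 Nf1 f1ge]] :=
  maximal_fine Dcount Dne Dmeas Dnest sigmafin p1 s0 ps mfE foo.
have f1oo : 'N[sigma]_p%:E[EFin \o f1] < +oo.
  by apply: (le_lt_trans Nf1); rewrite lte_mul_pinfty ?lee_fin ?(ltW s0).
pose c Q := (kappa Q)%:E / omega Q.
have c0 Q : D Q -> 0 <= c Q.
  by move=> DQ; rewrite mule_ge0 ?lee_fin ?kappa0// inve_ge0.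
have cE Q : D Q -> c Q * omega Q = (kappa Q)%:E.
  move=> DQ; rewrite /c; have [Q0|Q0] := eqVneq (omega Q) 0.
    by rewrite Q0 mule0 komega.
  by rewrite -muleA mulVe ?mule1// ge0_fin_numE// omegafin.
pose a Q := c Q * eavg sigma (EFin \o f1) Q.
have a0 Q : D Q -> 0 <= a Q by move=> DQ; rewrite mule_ge0 ?c0 ?eavg_ge0.
pose h := sumop D a.
have mh : measurable_fun setT h by exact: measurable_sumop.
have h0 x : 0 <= h x by exact: sumop_ge0.
have Nh : 'N[omega]_q%:E[h] <= C%:E * 'N[sigma]_p%:E[EFin \o f1].
  exact: (operator_bounded_of_pairing omegafin c0 cE q0 r0 qr C0 H).
have b0 Q : D Q -> 0 <= Ksum Q / omega Q * eavg sigma (EFin \o f) Q.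
  move=> DQ; apply: mule_ge0; last exact: eavg_ge0.
  by apply: mule_ge0; [exact: Ksum_ge0|rewrite inve_ge0].
apply: (@le_trans _ _ 'N[omega]_q%:E[supop D (eavg omega h)]).
  apply: le_Lnorm => //; try exact: measurable_supop.
  move=> x; rewrite !gee0_abs; first last.
  - exact: supop_ge0.
  - by apply: supop_ge0 => // Q _; exact: eavg_ge0.
  apply: ge_ereal_sup => _ [Q DQ <-]; apply: le_trans (le_supop _ x DQ).
  apply: lee_wpmul2r; first by rewrite lee_fin.
  rewrite /eavg muleAC -/(eavg sigma (EFin \o f) Q).
  apply: lee_wpmul2r; first by rewrite inve_ge0.
  set D' := [set S | D S /\ S `<=` Q].
  have D'count : countable D'.
    by apply: sub_countable Dcount; apply: subset_card_le => S [].
  have Efin : eavg sigma (EFin \o f) Q \is a fin_num.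
    exact: (eavg_fin Dmeas sigmafin (ltW p1) mfE foo).
  apply: (@le_trans _ _ (\int[omega]_(x in Q)
      \esum_(S in D') (a S * (\1_S x)%:E))).
    rewrite integral_esum//; first last.
    - exact: Dmeas.
    - by move=> S y [DS _]; rewrite mule_ge0 ?a0 ?lee_fin.
    - by move=> S [DS _]; apply: measurable_cube_term Dmeas _ _ DS.
    rewrite muleC -(fineK Efin) -ge0_esumZl//; last 2 first.
    - by move=> S [DS _]; rewrite lee_fin kappa0.
    - by rewrite fine_ge0// eavg_ge0.
    (* Term by term: [a S] integrates over [S] to [kappa S] times the average of [f1] over [S]. As
       [S] lies in [Q], the maximal function of [f] is at least the average of [f] over [Q]
       everywhere on [S]. *)
    apply: le_esum => S [DS SQ].
    have mS : measurable_fun Q (fun y => (\1_S y : R)%:E).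
      by apply: measurable_funTS; apply/measurable_EFinP/measurable_indic/Dmeas.
    have iS0 y : Q y -> 0 <= (\1_S y : R)%:E by rewrite lee_fin.
    rewrite (ge0_integralZl omega (Dmeas DQ) mS iS0 (a0 _ DS)).
    rewrite integral_indic//; [|exact: Dmeas|exact: Dmeas].
    rewrite (setIidl SQ) /a muleAC cE// (fineK Efin) muleC.
    (* If [sigma S = 0] the average of [f1] over [S] is 0 and dominates nothing, but then
       [kappa S = 0]. *)
    have [k0|k0] := eqVneq (kappa S) 0%R; first by rewrite k0 !mul0e.
    apply: lee_wpmul2l; first by rewrite lee_fin kappa0.
    rewrite -(fineK Efin); apply: f1ge => //.
    - by apply: contra k0 => /eqP S0; apply/eqP; exact: ksigma.
    - by rewrite fine_ge0// eavg_ge0.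
    - by move=> y Sy; rewrite fineK//; apply: le_supop_mem => //; exact: SQ.
  apply: ge0_le_integral.
  - exact: Dmeas.
  - by move=> y _; apply: esum_ge0 => S [DS _]; rewrite mule_ge0 ?a0 ?lee_fin.
  - apply: measurable_funTS; apply: measurable_esum => //.
    + by move=> S [DS _]; apply: measurable_cube_term Dmeas _ _ DS.
    + by move=> S y [DS _]; rewrite mule_ge0 ?a0 ?lee_fin.
  - by apply: measurable_funTS; exact: measurableT_comp.
  - move=> y _; rewrite gee0_abs//.
    rewrite /h /sumop (_ : D' = D `&` [set S | S `<=` Q])// esum_mkcondr.
    apply: le_esum => S DS; case: ifPn => // _.
    by rewrite mule_ge0 ?a0 ?lee_fin.
(* The factor [r] is Doob's constant for [omega] in exponent [q], [C] bounds the operator, and [s]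
   is Doob's constant in passing from [f] to [f1]. *)
apply: (le_trans (doob Dcount Dne Dmeas Dnest omegafin q1 r0 qr mh)).
rewrite -mulrA EFinM -muleA; apply: lee_wpmul2l; first by rewrite lee_fin ltW.
apply: (le_trans Nh); rewrite EFinM -muleA; apply: lee_wpmul2l => //.
Qed.

End maximal_of_pairing.

End bilinear.

(** * From the maximal operators to the bilinear form *)

Section pairing_of_maximal.
Context {d : measure_display} {T : measurableType d} {R : realType}.
Variables (D : set (set T)) (kappa : set T -> R).
Hypothesis Dcount : countable D.
Hypothesis Dne : D !=set0.
Hypothesis Dmeas : forall Q, D Q -> measurable Q.
Hypothesis Dnest : nested D.
Hypothesis kappa0 : forall Q, D Q -> (0 <= kappa Q)%R.

Definition favg (mu : {measure set T -> \bar R}) (f : T -> R) (Q : set T) : R :=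
  fine (eavg mu (EFin \o f) Q).

Lemma Ksum_fin_le (F : seq (set T)) S : uniq F -> {in F, forall Q, D Q} ->
  (\sum_(Q <- F | (Q <= S)%O) kappa Q)%:E <= Ksum D kappa S.
Proof.
move=> uF FD; apply: esum_ge.
exists [set` [seq Q <- F | (Q <= S)%O]].
  split; first exact: finite_seq.
  move=> Q; rewrite /= mem_filter => /andP[QS /FD DQ].
  by split=> //; rewrite subsetEset in QS.
by rewrite -fsbig_seq ?filter_uniq// big_filter sumEFin.
Qed.

(* The averages of [f] over the ancestors of [S] are at most the maximal
   function of [f] on [S], and the increments of the running maximum of the
   averages of [g] telescope, at each point, to at most the maximal function of
   [g]. *)
Lemma maximal_half_bound (sigma omega : {measure set T -> \bar R})
    (p s q r C : R) (f g : T -> R) (F : seq (set T)) :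
  (forall Q, D Q -> sigma Q < +oo) -> (forall Q, D Q -> omega Q < +oo) ->
  (forall Q, D Q -> sigma Q = 0 -> kappa Q = 0%R) ->
  (forall Q, D Q -> omega Q = 0 -> kappa Q = 0%R) ->
  (1 < p)%R -> (0 < s)%R -> (p^-1 + s^-1 = 1)%R ->
  (0 < q)%R -> (1 < r)%R -> (q^-1 + r^-1 = 1)%R -> (0 <= C)%R ->
  (forall f : T -> R, measurable_fun setT f ->
    'N[omega]_q%:E[supop D
        (fun Q => Ksum D kappa Q / omega Q * eavg sigma (EFin \o f) Q)]
      <= C%:E * 'N[sigma]_p%:E[EFin \o f]) ->
  measurable_fun setT f -> measurable_fun setT g ->
  'N[sigma]_p%:E[EFin \o f] < +oo -> 'N[omega]_r%:E[EFin \o g] < +oo ->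
  uniq F -> {in F, forall Q, D Q} ->
  (\sum_(S <- F) (\sum_(Q <- F | (Q <= S)%O) kappa Q)
     * (maxge (favg sigma f) F S
        * (maxge (favg omega g) F S - maxgt (favg omega g) F S)))%:E
  <= (C * s * q)%:E * ('N[sigma]_p%:E[EFin \o f] * 'N[omega]_r%:E[EFin \o g]).
Proof.
move=> sfin wfin ks kw p1 s0 ps q0 r1 qr C0 H mf mg foo goo uF FD.
set u := favg sigma f; set v := favg omega g.
have r0 : (0 < r)%R by exact: lt_trans r1.
have mfE : measurable_fun setT (EFin \o f) by exact/measurable_EFinP.
have mgE : measurable_fun setT (EFin \o g) by exact/measurable_EFinP.
have [f1 [mf1 Nf1 f1ge]] :=
  maximal_fine Dcount Dne Dmeas Dnest sfin p1 s0 ps mfE foo.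
pose w Q := Ksum D kappa Q / omega Q * eavg sigma (EFin \o f1) Q.
have w0 Q : 0 <= w Q.
  apply: mule_ge0; last exact: eavg_ge0.
  by apply: mule_ge0; [exact: Ksum_ge0|rewrite inve_ge0].
set N1 := supop D w; set Mg := supop D (eavg omega (EFin \o g)).
have mN1 : measurable_fun setT N1 by exact: measurable_supop.
have mMg : measurable_fun setT Mg by exact: measurable_supop.
have N10 x : 0 <= N1 x by exact: supop_ge0.
have Mg0 x : 0 <= Mg x by apply: supop_ge0 => // Q _; exact: eavg_ge0.
have NN1 : 'N[omega]_q%:E[N1] <= (C * s)%:E * 'N[sigma]_p%:E[EFin \o f].
  apply: (le_trans (H f1 mf1)); rewrite EFinM -muleA.
  by apply: lee_wpmul2l; rewrite ?lee_fin.
have NMg : 'N[omega]_r%:E[Mg] <= q%:E * 'N[omega]_r%:E[EFin \o g].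
  by apply: (doob Dcount Dne Dmeas Dnest wfin r1 q0 _ mgE); rewrite addrC.
have N1oo : 'N[omega]_q%:E[N1] < +oo.
  apply: (le_lt_trans NN1).
  by rewrite lte_mul_pinfty ?lee_fin ?mulr_ge0 ?(ltW s0).
have Mgoo : 'N[omega]_r%:E[Mg] < +oo.
  by apply: (le_lt_trans NMg); rewrite lte_mul_pinfty ?lee_fin ?(ltW q0).
(* Hölder: [C * s] bounds [N1], with [s] from passing to [f1], and [q] is Doob's constant for [g] in
   exponent [r]. *)
apply: (@le_trans _ _ (\int[omega]_x `|N1 x * Mg x|)); last first.
  apply: le_trans (ehoelder q0 r0 qr mN1 mMg N1oo Mgoo) _.
  apply: (@le_trans _ _ (((C * s)%:E * 'N[sigma]_p%:E[EFin \o f])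
                         * (q%:E * 'N[omega]_r%:E[EFin \o g]))).
    by apply: lee_pmul => //; exact: Lnorm_ge0.
  by rewrite muleACA -EFinM.
pose dv S := (maxge v F S - maxgt v F S)%R.
have dv0 S : (0 <= dv S)%R by rewrite subr_ge0 maxgt_le_maxge.
have m1 S : S \in F ->
    measurable_fun setT (fun x => (dv S)%:E * (w S * (\1_S x)%:E)).
  move=> SF; do 2 apply: measurable_funeM.
  by apply/measurable_EFinP/measurable_indic/Dmeas/FD.
have i0 S x : 0 <= (dv S)%:E * (w S * (\1_S x)%:E).
  apply: mule_ge0; first by rewrite lee_fin dv0.
  by apply: mule_ge0; [exact: w0|rewrite lee_fin].
apply: (@le_trans _ _ (\int[omega]_x
    \sum_(S <- F) (dv S)%:E * (w S * (\1_S x)%:E))); last first.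
  apply: ge0_le_integral => //.
  - by move=> x _; apply: sume_ge0 => S _; exact: i0.
  - by apply: emeasurable_sum_in; exact: m1.
  - by apply: measurableT_comp => //; exact: emeasurable_funM.
  move=> x _; rewrite gee0_abs ?mule_ge0//.
  (* If [x] lies in [S] then [w S] is at most [N1 x], and the increments over all such [S] add up to
     [finmax F v x], itself at most [Mg x]. *)
  apply: (@le_trans _ _ (N1 x * (finmax F v x)%:E)).
    rewrite (finmaxE Dnest v uF FD) -sumEFin ge0_sume_distrr; last first.
      by move=> S _; rewrite lee_fin mulr_ge0// dv0.
    rewrite big_seq [leRHS]big_seq; apply: lee_sum => S SF.
    rewrite EFinM [leRHS]muleCA; apply: lee_wpmul2l; first by rewrite lee_fin dv0.
    rewrite indicE; have [xS|_] := boolP (x \in S); last by rewrite !mule0.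
    by rewrite !mule1; apply: le_supop_mem; [exact: FD|exact/set_mem].
  apply: lee_wpmul2l => //.
  rewrite /finmax big_seq_cond.
  elim/big_rec : _ => [|Q y /andP[QF xQ] yM]; first exact: Mg0.
  rewrite EFin_max ge_max yM andbT fineK; last first.
    by apply: (eavg_fin Dmeas wfin (ltW r1)) => //; exact: FD.
  by apply: le_supop_mem; [exact: FD|exact/set_mem].
rewrite (ge0_integral_sum_in omega m1 (fun S _ => i0 S)).
rewrite -sumEFin big_seq [leRHS]big_seq; apply: lee_sum => S SF.
have DS := FD _ SF.
have mS : measurable_fun setT (fun x => (\1_S x : R)%:E).
  by apply/measurable_EFinP/measurable_indic/Dmeas.
have iS0 x : setT x -> 0 <= (\1_S x : R)%:E by rewrite lee_fin.
rewrite (@ge0_integralZl _ _ _ omega setT measurableT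
  (fun x => w S * (\1_S x)%:E)); first last.
- by rewrite lee_fin dv0.
- by move=> x _; apply: mule_ge0; [exact: w0|rewrite lee_fin].
- exact: measurable_funeM.
rewrite (ge0_integralZl omega measurableT mS iS0 (w0 S)).
rewrite integral_indic//; last exact: Dmeas.
rewrite setIT mulrA mulrC EFinM.
apply: lee_wpmul2l; first by rewrite lee_fin dv0.
(* If either measure vanishes on [S], so does [kappa] on every set of [F] inside [S]. Otherwise
   [omega S] cancels and [f1ge] applies. *)
have kF0 (mu : {measure set T -> \bar R}) :
    (forall Q, D Q -> mu Q = 0 -> kappa Q = 0%R) -> mu S = 0 ->
    (\sum_(Q <- F | (Q <= S)%O) kappa Q = 0)%R.
  move=> kmu S0; rewrite big_seq_cond big1// => Q /andP[QF QS].
  apply: (kmu); first exact: FD.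
  rewrite subsetEset in QS.
  by apply: subset_measure0 S0 => //; [exact/Dmeas/FD|exact: Dmeas].
have [S0|S0] := eqVneq (omega S) 0.
  by rewrite (kF0 _ kw S0) mul0r S0 mule0.
have [S1|S1] := eqVneq (sigma S) 0.
  by rewrite (kF0 _ ks S1) mul0r mule_ge0 ?w0.
have wSfin : omega S \is a fin_num by rewrite ge0_fin_numE// wfin.
rewrite /w muleAC -(muleA (Ksum _ _ _)) mulVe// mule1 EFinM.
apply: lee_pmul.
- rewrite lee_fin big_seq_cond sumr_ge0// => Q /andP[QF _].
  exact/kappa0/FD.
- by rewrite lee_fin maxge_ge0.
- exact: Ksum_fin_le.
apply: f1ge => //; first exact: maxge_ge0.
move=> x Sx; rewrite /maxge big_seq_cond.
elim/big_rec : _ => [|Q y /andP[QF SQ] yM].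
  by apply: supop_ge0 => // Q _; exact: eavg_ge0.
rewrite EFin_max ge_max yM andbT fineK; last first.
  by apply: (eavg_fin Dmeas sfin (ltW p1)) => //; exact: FD.
apply: le_supop_mem; first exact: FD.
by rewrite subsetEset in SQ; exact: SQ.
Qed.

(** An unordered sum is the supremum of its finite partial sums, so a bound uniform over finite [F]
    suffices. [abel_chain_le] splits such a sum in two; [maximal_half_bound] treats each half, the
    second with [(sigma, p, s)] and [(omega, r, q)] exchanged. *)
Lemma pairing_bounded_of_maximal (sigma omega : {measure set T -> \bar R})
    (p s q r C : R) :
  (forall Q, D Q -> sigma Q < +oo) -> (forall Q, D Q -> omega Q < +oo) ->
  (forall Q, D Q -> sigma Q = 0 -> kappa Q = 0%R) ->
  (forall Q, D Q -> omega Q = 0 -> kappa Q = 0%R) ->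
  (1 < p)%R -> (0 < s)%R -> (p^-1 + s^-1 = 1)%R ->
  (0 < q)%R -> (1 < r)%R -> (q^-1 + r^-1 = 1)%R -> (0 <= C)%R ->
  (forall f : T -> R, measurable_fun setT f ->
    'N[omega]_q%:E[supop D
        (fun Q => Ksum D kappa Q / omega Q * eavg sigma (EFin \o f) Q)]
      <= C%:E * 'N[sigma]_p%:E[EFin \o f]) ->
  (forall g : T -> R, measurable_fun setT g ->
    'N[sigma]_s%:E[supop D
        (fun Q => Ksum D kappa Q / sigma Q * eavg omega (EFin \o g) Q)]
      <= C%:E * 'N[omega]_r%:E[EFin \o g]) ->
  pairing_bounded D kappa sigma omega p r (C * s * q + C * q * s).
Proof.
move=> sfin wfin ks kw p1 s0 ps q0 r1 qr C0 H1 H2 f g mf mg foo goo.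
have mfE : measurable_fun setT (EFin \o f) by exact/measurable_EFinP.
have mgE : measurable_fun setT (EFin \o g) by exact/measurable_EFinP.
set N := 'N[sigma]_p%:E[_] * 'N[omega]_r%:E[_].
have N0 : 0 <= N by apply: mule_ge0; exact: Lnorm_ge0.
apply: ge_ereal_sup => _ [X [Xfin XD] <-]; rewrite fsbig_finite//.
have uF := finmap.fset_uniq (fset_set X).
have FD : {in finmap.enum_fset (fset_set X), forall Q, D Q}.
  by move=> Q QX; apply/XD/set_mem; rewrite -in_fset_set.
move: (finmap.enum_fset _) uF FD => F uF FD.
have u0 Q : (0 <= favg sigma f Q)%R by rewrite fine_ge0// eavg_ge0.
have v0 Q : (0 <= favg omega g Q)%R by rewrite fine_ge0// eavg_ge0.
apply: (@le_trans _ _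
    (\sum_(Q <- F) kappa Q * favg sigma f Q * favg omega g Q)%:E).
  rewrite -sumEFin big_seq [leRHS]big_seq; apply: lee_sum => Q QF.
  have DQ := FD _ QF; rewrite !EFinM !fineK//.
    exact: (eavg_fin Dmeas wfin (ltW r1)).
  exact: (eavg_fin Dmeas sfin (ltW p1)).
have k0 : {in F, forall Q, (0 <= kappa Q)%R} by move=> Q /FD /kappa0.
apply: (@le_trans _ _ (\sum_(S <- F) (\sum_(Q <- F | (Q <= S)%O) kappa Q) *
    (maxge (favg sigma f) F S
       * (maxge (favg omega g) F S - maxgt (favg omega g) F S)
     + maxge (favg omega g) F S
       * (maxge (favg sigma f) F S - maxgt (favg sigma f) F S)))%:E).
  rewrite lee_fin; apply: abel_chain_le => // Q QF kQ.
  (* The empty set has measure 0, hence zero weight. A point of [Q] lies in all ancestors of [Q],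
     which therefore form a chain. *)
  have [x Qx] : Q !=set0.
    by apply/set0P; apply: contra kQ => /eqP Q0; apply/eqP/ks;
      [exact: FD|rewrite Q0 measure0].
  move=> S S'; rewrite !inE => /andP[SF QS] /andP[S'F QS'].
  rewrite !subsetEset in QS QS' *.
  have [SS'|S'S|SS0] := Dnest (FD _ SF) (FD _ S'F).
  - by apply/orP; left; rewrite subsetEset.
  - by apply/orP; right; rewrite subsetEset.
  - suff : set0 x by [].
    by rewrite -SS0; split; [exact: QS|exact: QS'].
under eq_bigr do rewrite mulrDr.
rewrite big_split EFinD [in leRHS]EFinD ge0_muleDl; last 2 first.
- by rewrite lee_fin !mulr_ge0 ?(ltW s0) ?(ltW q0).
- by rewrite lee_fin !mulr_ge0 ?(ltW s0) ?(ltW q0).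
apply: leeD.
  exact: maximal_half_bound.
rewrite /N (muleC 'N[sigma]_p%:E[_]).
by apply: maximal_half_bound => //; rewrite addrC.
Qed.

End pairing_of_maximal.

(** * Dyadic cubes *)

Lemma measure_bigsetU_lty d (T : measurableType d) (R : realType)
    (mu : {measure set T -> \bar R}) (I : eqType) (s : seq I) (f : I -> set T) :
  {in s, forall i, measurable (f i)} -> {in s, forall i, mu (f i) < +oo} ->
  measurable (\big[setU/set0]_(i <- s) f i) /\
  mu (\big[setU/set0]_(i <- s) f i) < +oo.
Proof.
elim: s => [|i s ih] ms fs; first by rewrite big_nil measure0.
have [j js|j js|mu1 fu1] := ih.
- by apply: ms; rewrite inE js orbT.
- by apply: fs; rewrite inE js orbT.
have mi : measurable (f i) by apply: ms; rewrite inE eqxx.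
rewrite big_cons; split; first exact: measurableU.
apply: (le_lt_trans (measureU2 _ mi mu1)).
by rewrite lte_add_pinfty// fs// inE eqxx.
Qed.

Section dyadic_cubes.
Context {R : realType} {d : nat}.

Lemma open_measurableRn (U : set 'rV[R]_d) : open U ->
  measurable (U : set (Rn R d)).
Proof. by move=> oU; exact: sub_sigma_algebra. Qed.

Lemma countable_dyadic : countable (dyadic R d).
Proof.
rewrite (_ : dyadic R d =
  (fun km : int * 'rV[int]_d => dyadic_cube km.1 km.2) @` setT).
  exact: card_le_trans (card_image_le _ _) (countableP _).
apply/seteqP; split => [Q [k [m ->]]|_ [[k m] _ <-]]; first by exists (k, m).
by exists k, m.
Qed.

Lemma dyadic_neq0 : dyadic R d !=set0.
Proof. by exists (dyadic_cube 0 0); exists 0%R, 0%R. Qed.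

Lemma measurable_dyadic (Q : set (Rn R d)) : dyadic R d Q -> measurable Q.
Proof.
move=> [k [m ->]].
have mlt (i : 'I_d) (b : R) :
    measurable ([set x : 'rV[R]_d | x ord0 i < b]%R : set (Rn R d)).
  apply: open_measurableRn.
  apply: (@open_comp _ _ (fun x : 'rV[R]_d => x ord0 i) [set y | y < b]%R).
    by move=> x _; exact: coord_continuous.
  exact: open_lt.
rewrite (_ : dyadic_cube k m = \bigcap_(i in [set: 'I_d])
   ((~` [set x : 'rV[R]_d | x ord0 i < (2 : R) ^ (- k) * (m ord0 i)%:~R]%R)
    `&` [set x : 'rV[R]_d |
           x ord0 i < (2 : R) ^ (- k) * ((m ord0 i)%:~R + 1)]%R)).
  apply: fin_bigcap_measurable => // i _.
  by apply: measurableI => //; exact: measurableC.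
apply/seteqP; split => x /= xQ i; last first.
  by have [/negP] := xQ i I; rewrite -leNgt => -> ->.
by move=> _; have /andP[h1 h2] := xQ i; split => //; apply/negP; rewrite -leNgt.
Qed.

(** In units of the finer side length [t], the coarse cube has integer endpoints [N m] and
    [N (m + 1)]. A common point gives [N m < n + 1] and [n < N (m + 1)], which sharpen to [N m <= n]
    and [n + 1 <= N (m + 1)] for integers. *)
Lemma dyadic_cube_sub (k : int) (e : nat) (m n : 'rV[int]_d) (x : Rn R d) :
  dyadic_cube k m x -> dyadic_cube (k + e%:Z) n x ->
  dyadic_cube (k + e%:Z) n `<=` (dyadic_cube k m : set (Rn R d)).
Proof.
move=> xQ xS y yS i.
have /andP[xQ1 xQ2] := xQ i; have /andP[xS1 xS2] := xS i.
have /andP[yS1 yS2] := yS i.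
set t := ((2 : R) ^ (- (k + e%:Z)))%R in xS1 xS2 yS1 yS2.
have t0 : (0 < t)%R by rewrite exprz_gt0.
have E : ((2 : R) ^ (- k) = t * ((2 ^ e)%N%:Z)%:~R)%R.
  have -> : (((2 ^ e)%N%:Z)%:~R = (2 : R) ^+ e)%R by rewrite -pmulrn natrX.
  by rewrite /t opprD expfzDr// -mulrA -exprnN mulVf ?mulr1// expf_neq0.
rewrite E in xQ1 xQ2 *.
set N := ((2 ^ e)%N%:Z)%R in xQ1 xQ2 *.
have h1 : (N * m ord0 i <= n ord0 i)%R.
  rewrite -ltzD1 -(ltr_int R) -(ltr_pM2l t0) intrM intrD mulrA.
  exact: le_lt_trans xQ1 xS2.
have h2 : (n ord0 i + 1 <= N * (m ord0 i + 1))%R.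
  rewrite lezD1 -(ltr_int R) -(ltr_pM2l t0) intrM intrD mulrA.
  exact: le_lt_trans xS1 xQ2.
rewrite -!mulrA -(intrD _ _ 1) -!intrM; apply/andP; split.
  apply: le_trans yS1; rewrite ler_pM2l// ler_int; exact: h1.
apply: (lt_le_trans yS2); rewrite -(intrD _ _ 1) ler_pM2l// ler_int.
exact: h2.
Qed.

Lemma nested_dyadic : nested (dyadic R d).
Proof.
move=> _ _ [k [m ->]] [l [n ->]].
have [->|/set0P[x [xQ xS]]] := eqVneq (dyadic_cube k m `&` dyadic_cube l n)
  (set0 : set (Rn R d)); first by apply: Or33.
have [kl|lk] := leP k l.
  apply: Or32; have [e El] : exists e : nat, l = (k + e%:Z)%R.
    by exists `|l - k|%N; rewrite gez0_abs ?subr_ge0// subrKC.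
  by rewrite El in xS *; exact: dyadic_cube_sub xQ xS.
apply: Or31; have [e El] : exists e : nat, k = (l + e%:Z)%R.
  by exists `|k - l|%N; rewrite gez0_abs ?subr_ge0 ?(ltW lk)// subrKC.
by rewrite El in xQ *; exact: dyadic_cube_sub xS xQ.
Qed.

(** The closed cube is compact, so finitely many open sets of finite measure cover it. *)
Lemma dyadic_measure_lty (mu : {measure set (Rn R d) -> \bar R}) :
  locally_finite mu -> forall Q, dyadic R d Q -> mu Q < +oo.
Proof.
move=> lf Q DQ; have mQ := measurable_dyadic DQ; case: DQ mQ => k [m ->] mQ.
pose a (i : 'I_d) := ((2 : R) ^ (- k) * (m ord0 i)%:~R)%R.
pose b (i : 'I_d) := ((2 : R) ^ (- k) * ((m ord0 i)%:~R + 1))%R.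
pose K := [set x : 'rV[R]_d | forall i, [set` `[a i, b i]] (x ord0 i)].
have cK : compact K.
  exact: (@rV_compact _ _ (fun i => [set` `[a i, b i]])
    (fun i => @segment_compact R (a i) (b i))).
rewrite compact_cover in cK.
pose U x := sval (cid (lf x)).
have Uprop x : [/\ open (U x), U x x & mu (U x) < +oo].
  exact: (svalP (cid (lf x))).
have [|x _|X _ KX] := cK _ setT U.
- by move=> x _; have [] := Uprop x.
- by exists x => //; have [] := Uprop x.
have [||mX fX] := @measure_bigsetU_lty _ _ _ mu _ (finmap.enum_fset X) U.
- by move=> x _; apply: open_measurableRn; have [] := Uprop x.
- by move=> x _; have [] := Uprop x.
apply: le_lt_trans fX; apply: le_measure; rewrite ?inE//.
move=> x xQ; rewrite -bigcup_seq; apply: KX => i /=.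
by rewrite in_itv/=; have /andP[-> /ltW ->] := xQ i.
Qed.

End dyadic_cubes.

(** * The equivalence for dyadic cubes *)

Lemma eq_supop (T : Type) (R : realType) (D : set (set T))
    (a b : set T -> \bar R) :
  (forall Q, D Q -> a Q = b Q) -> supop D a = supop D b.
Proof.
move=> ab; apply/funext => x; rewrite /supop; congr ereal_sup.
by apply/seteqP; split => _ [Q DQ <-]; exists Q; rewrite ?ab.
Qed.

Lemma conj_exponent (R : realType) (p : R) : (1 < p)%R ->
  (1 < p / (p - 1))%R /\ (p^-1 + (p / (p - 1))^-1 = 1)%R.
Proof.
move=> p1; have p0 : (0 < p)%R by exact: lt_trans p1.
have pB : (0 < p - 1)%R by rewrite subr_gt0.
split; first by rewrite ltr_pdivlMr// mul1r gtrBl.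
by field; rewrite !gt_eqF.
Qed.

(** When [f] has infinite norm the bound holds because [C'] is positive; with constant 0 the
    right-hand side would be [0 * +oo = 0]. Hence the strict inequality [C < C']. *)
Lemma Lnorm_bound_extend d (T : measurableType d) (R : realType)
    (mu : {measure set T -> \bar R}) (p C C' : R) (f : T -> R) (N : \bar R) :
  (0 <= C)%R -> (C < C')%R ->
  ('N[mu]_p%:E[EFin \o f] < +oo -> N <= C%:E * 'N[mu]_p%:E[EFin \o f]) ->
  N <= C'%:E * 'N[mu]_p%:E[EFin \o f].
Proof.
move=> C0 CC' H; have [foo|] := ltP 'N[mu]_p%:E[EFin \o f] +oo.
  apply: (le_trans (H foo)); apply: lee_wpmul2r; first exact: Lnorm_ge0.
  by rewrite lee_fin ltW.
rewrite leye_eq => /eqP ->; rewrite gt0_muley ?leey// lte_fin.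
exact: le_lt_trans CC'.
Qed.

(* The hypothesis [lambda_nondeg] says that omega(Q) Lambda_Q / sigma(Q) is
   never of the form (positive) / 0, the convention 0 / 0 := 0 being the only
   one available; without it (i) does not imply (ii). *)
Theorem proposition2p3 (R : realType) (d : nat) (d_gt0 : (0 < d)%N)
  (sigma omega : {measure set (Rn R d) -> \bar R})
  (sigma_lf : locally_finite sigma) (omega_lf : locally_finite omega)
  (p q : R) (q_gt1 : (1 < q)%R) (qp : (q < p)%R)
  (lambda : set (Rn R d) -> R)
  (lambda_ge0 : forall Q, dyadic R d Q -> (0 <= lambda Q)%R)
  (lambda_nondeg : forall Q, dyadic R d Q -> sigma Q = 0 ->
     (lambda Q)%:E * omega Q = 0) :
  let p' := (p / (p - 1))%R in
  let q' := (q / (q - 1))%R in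
  (exists C : R, forall f : Rn R d -> R, measurable_fun setT f ->
     'N[omega]_(q%:E)[dyadic_sum (fun Q => (lambda Q)%:E * average sigma f Q)]
       <= C%:E * 'N[sigma]_(p%:E)[EFin \o f])
  <->
  (exists C : R,
     (forall f : Rn R d -> R, measurable_fun setT f ->
        'N[omega]_(q%:E)[dyadic_sup
             (fun Q => Lambda omega lambda Q * average sigma f Q)]
          <= C%:E * 'N[sigma]_(p%:E)[EFin \o f])
     /\
     (forall g : Rn R d -> R, measurable_fun setT g ->
        'N[sigma]_(p'%:E)[dyadic_sup
             (fun Q => omega Q / sigma Q * Lambda omega lambda Q
                       * average omega g Q)]
          <= C%:E * 'N[omega]_(q'%:E)[EFin \o g])).
Proof.
move=> p' q'.
have p1 : (1 < p)%R by exact: lt_trans qp.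
have [p'1 pp'] := conj_exponent p1; have [q'1 qq'] := conj_exponent q_gt1.
rewrite -/p' in p'1 pp'; rewrite -/q' in q'1 qq'.
clearbody p' q'.
have p0 : (0 < p)%R by exact: lt_trans p1.
have q0 : (0 < q)%R by exact: lt_trans q_gt1.
have p'0 : (0 < p')%R by exact: lt_trans p'1.
have q'0 : (0 < q')%R by exact: lt_trans q'1.
have Dc := @countable_dyadic R d; have Dn := @dyadic_neq0 R d.
have Dm := @measurable_dyadic R d; have Dnest := @nested_dyadic R d.
have sfin := dyadic_measure_lty sigma_lf.
have wfin := dyadic_measure_lty omega_lf.
pose kappa Q := (lambda Q * fine (omega Q))%R.
have kE Q : dyadic R d Q -> (lambda Q)%:E * omega Q = (kappa Q)%:E.
  by move=> DQ; rewrite EFinM fineK// ge0_fin_numE// wfin.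
have k0 Q : dyadic R d Q -> (0 <= kappa Q)%R.
  by move=> DQ; rewrite mulr_ge0 ?lambda_ge0 ?fine_ge0.
have ks Q : dyadic R d Q -> sigma Q = 0 -> kappa Q = 0%R.
  by move=> DQ Q0; apply: EFin_inj; rewrite -kE//; exact: lambda_nondeg.
have kw Q : dyadic R d Q -> omega Q = 0 -> kappa Q = 0%R.
  by move=> DQ Q0; rewrite /kappa Q0 mulr0.
have l0 Q : dyadic R d Q -> 0 <= (lambda Q)%:E.
  by move=> DQ; rewrite lee_fin lambda_ge0.
have LE Q : Lambda omega lambda Q = Ksum (dyadic R d) kappa Q / omega Q.
  by rewrite /Lambda /Ksum; congr (_ / _); apply: eq_esum => S [DS _]; exact: kE.
have LE' Q : dyadic R d Q ->
    omega Q / sigma Q * Lambda omega lambda Q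
      = Ksum (dyadic R d) kappa Q / sigma Q.
  (* On a cube that is null for either measure [Ksum] vanishes and both sides are 0; elsewhere
     [omega Q] cancels. *)
  move=> DQ; rewrite LE; have [w0|w0] := eqVneq (omega Q) 0.
    by rewrite (Ksum_eq0 Dm kw DQ w0) !mul0e mule0.
  have [s0|s0] := eqVneq (sigma Q) 0.
    by rewrite (Ksum_eq0 Dm ks DQ s0) !mul0e mule0.
  have wQ : omega Q \is a fin_num by rewrite ge0_fin_numE// wfin.
  rewrite (muleC (omega Q)) muleACA (muleC (omega Q)) mulVe// mule1.
  exact: muleC.
have sup1 f : dyadic_sup (fun Q => Lambda omega lambda Q * average sigma f Q)
    = supop (dyadic R d) (fun Q => Ksum (dyadic R d) kappa Q / omega Q
                                   * eavg sigma (EFin \o f) Q).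
  by apply: eq_supop => Q _; rewrite LE.
have sup2 g : dyadic_sup (fun Q => omega Q / sigma Q * Lambda omega lambda Q
                                   * average omega g Q)
    = supop (dyadic R d) (fun Q => Ksum (dyadic R d) kappa Q / sigma Q
                                   * eavg omega (EFin \o g) Q).
  by apply: eq_supop => Q DQ; rewrite LE'.
(* The constants in (i) and (ii) carry no sign, so they are replaced by their absolute values. *)
have normC (C : R) (N : \bar R) : 0 <= N -> C%:E * N <= `|C|%:E * N.
  by move=> N0; apply: lee_wpmul2r => //; rewrite lee_fin ler_norm.
split=> [[C H]|[C [H1 H2]]].
  have PB : pairing_bounded (dyadic R d) kappa sigma omega p q' `|C|%R.
    apply: (pairing_bounded_of_operator (c := fun Q => (lambda Q)%:E)
      Dc Dm wfin l0 kE q0 q'0 qq' (normr_ge0 C)) => f mf.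
    by apply: le_trans (H f mf) (normC _ _ _); exact: Lnorm_ge0.
  have PB' := pairing_boundedC PB.
  (* [C2] is [C1] with [(sigma, p, p')] and [(omega, q', q)] exchanged. Adding 1 below makes the
     common constant strictly larger than both. *)
  pose C1 := (q' * `|C| * p')%R; pose C2 := (p * `|C| * q)%R.
  have C10 : (0 <= C1)%R by rewrite !mulr_ge0// ltW.
  have C20 : (0 <= C2)%R by rewrite !mulr_ge0// ltW.
  exists (C1 + C2 + 1)%R; split=> [f mf|g mg].
    rewrite sup1; apply: (Lnorm_bound_extend C10); first by lra.
    move=> foo; exact: (maximal_bounded_of_pairing Dc Dn Dm Dnest k0 sfin wfin
      ks kw p1 p'0 pp' q_gt1 q'0 qq' (normr_ge0 C) PB mf foo).
  rewrite sup2; apply: (Lnorm_bound_extend C20); first by lra.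
  have q'q : (q'^-1 + q^-1 = 1)%R by rewrite addrC.
  have p'p : (p'^-1 + p^-1 = 1)%R by rewrite addrC.
  move=> goo; exact: (maximal_bounded_of_pairing Dc Dn Dm Dnest k0 wfin sfin
    kw ks q'1 q0 q'q p'1 p0 p'p (normr_ge0 C) PB' mg goo).
pose C3 := (`|C| * p' * q + `|C| * q * p')%R.
have C30 : (0 <= C3)%R by rewrite addr_ge0// !mulr_ge0// ltW.
have PB : pairing_bounded (dyadic R d) kappa sigma omega p q' C3.
  apply: (pairing_bounded_of_maximal Dc Dn Dm Dnest k0 sfin wfin ks kw
    p1 p'0 pp' q0 q'1 qq' (normr_ge0 C)) => [f mf|g mg].
    by rewrite -sup1; apply: le_trans (H1 f mf) (normC _ _ _); exact: Lnorm_ge0.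
  by rewrite -sup2; apply: le_trans (H2 g mg) (normC _ _ _); exact: Lnorm_ge0.
exists (C3 + 1)%R => f mf.
apply: (Lnorm_bound_extend C30); first by rewrite ltrDl.
move=> foo; exact: (operator_bounded_of_pairing (c := fun Q => (lambda Q)%:E)
  Dc Dn Dm wfin l0 kE q0 q'0 qq' C30 PB mf foo).
Qed.
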